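(* Let $(X,\alpha,p)$ be a planar $G$-framework with $G=\mathbb Z_m$ or $D_{2m}$, and let $(\mathcal F,\rho)$, $(\overline{k^2},\eta)$, $(\mathcal P,\eta/\rho)$, $\phi$, $\pi$ be as in the context. Let $T\subseteq C_2\overline{k^2}$ be the $G$-submodule of 2-chains assigning one and the same vector of $k^2$ to every face (these are exactly the 2-cycles, i.e. $T=H_2\overline{k^2}$). Then for every irreducible representation $\mu^{(j)}$ of $G$ over $k$ there is a short exact sequence of $kG$-modules $$0\to T^{(j)}\xrightarrow{\pi_*}H_2^{(j)}\mathcal P\xrightarrow{\vartheta^{(j)}}H_1^{(j)}\mathcal F\to0,$$ so that $\vartheta^{(j)}$ induces an isomorphism $H_2^{(j)}\mathcal P/\pi_*(T^{(j)})\cong H_1^{(j)}\mathcal F$: the $\mu^{(j)}$-symmetric self-stresses of the framework correspond bijectively and linearly to the $\mu^{(j)}$-symmetric reciprocal diagrams modulo $\mu^{(j)}$-symmetric global translations.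
   Context: Let $k\in\{\mathbb R,\mathbb C\}$ (when $k=\mathbb C$, points of $\mathbb R^2$ are regarded in $\mathbb C^2$). Let $G$ be $\mathbb Z_m$ or $D_{2m}$ with standard representation $\tau:G\to O(2)$ (rotation generator by $2\pi/m$; reflections in lines through the origin). A planar $G$-framework $(X,\alpha,p)$: $p_v\in\mathbb R^2$ for vertices of a finite graph, $p_u\ne p_v$ for adjacent $u,v$, straight edges meeting only at endpoints; $X$ is the regular cell complex homeomorphic to the 2-sphere with these vertices and edges and with faces the connected components of the complement of the drawing (including the unbounded one). $G$ acts on cells by incidence-preserving permutations $\alpha$ with $p_{gv}=\tau(g)p_v$, $g$ mapping the geometric realization of each cell $c$ onto that of $gc$. Fix a signed incidence relation $[c:d]$ ($[c:d]\ne0$ iff $c\lhd d$ in codimension one; $[u:e][v:e]=-1$ for endpoints of an edge; $\sum_c[b:c][c:d]=0$) with faces oriented consistently. Signs: $[gv,v]=+1$; $[ge,e]=[v:e][gv:ge]$ for an endpoint $v$ of $e$; $[gf,f]=+1$ for rotations, $-1$ for reflections. For a cosheaf $\mathcal K$ (stalks $\mathcal K_c$, functorial extension maps $\mathcal K_{d\rhd c}$ for $c\lhd d$), $C_i\mathcal K=\bigoplus_{\dim c=i}\mathcal K_c$, $(\partial x)_c=\sum_{c\lhd d}[c:d]\mathcal K_{d\rhd c}x_d$, $H_i\mathcal K=\ker\partial_i/\operatorname{im}\partial_{i+1}$. Force cosheaf $\mathcal F$: $\mathcal F_v=k^2$, $\mathcal F_e=k$, $\mathcal F_f=0$, $\mathcal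 F_{e\rhd v}(1)=\mathcal F_{e\rhd u}(1)=[v:e](p_v-p_u)$ for an edge $e$ with endpoints $u,v$; $G$ acts by $\rho_v(g)=\tau(g):\mathcal F_v\to\mathcal F_{gv}$, $\rho_e(g)=1:\mathcal F_e\to\mathcal F_{ge}$. $H_1\mathcal F=\ker\partial_1$ is the space of self-stresses $w$ (scalars $w_e$ with $\sum_{e\ni v}w_e(p_v-p_u)=0$ at each vertex $v$). Constant cosheaf $\overline{k^2}$: stalks $k^2$, identity extension maps, action $\eta_c(g)=[gc,c]\tau(g):k^2\to k^2$ from stalk at $c$ to stalk at $gc$. Cosheaf map $\phi:\mathcal F\to\overline{k^2}$: $\phi_v=\mathrm{id}$, $\phi_e(1)=[v:e](p_v-p_u)$. Position cosheaf $\mathcal P$: stalks $\mathcal P_c=k^2/\phi_c(\mathcal F_c)$ (so $\mathcal P_f=k^2$, $\mathcal P_e=k^2/\operatorname{span}(p_u-p_v)$, $\mathcal P_v=0$), induced extension maps, quotient map $\pi$, action $(\eta/\rho)_c(g)(x+\operatorname{im}\phi_c)=\eta_c(g)x+\operatorname{im}\phi_{gc}$. Elements of $H_2\mathcal P$ are reciprocal diagrams: assignments $\xi_f\in k^2$ to faces such that $\xi_f-\xi_{f'}\in\operatorname{span}(p_u-p_v)$ whenever faces $f,f'$ share the edge with endpoints $u,v$. The connecting homomorphism $\vartheta:H_2\mathcal P\to H_1\mathcal F$ sends the class of a 2-cycle $\xi$ to $\phi^{-1}(\partial\xi)$, where $\xi$ is viewed as a 2-chain of $\overline{k^2}$ and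 $\partial\xi\in\phi(C_1\mathcal F)$. All homology spaces are $kG$-modules via the induced actions. $\mu^{(1)},\dots,\mu^{(m')}$ are the irreducible representations of $G$ over $k$; $V^{(j)}$ denotes the $\mu^{(j)}$-isotypic component (sum of all submodules isomorphic to $\mu^{(j)}$) of a $kG$-module $V$, and $\vartheta^{(j)},\pi_*$ denote restrictions to isotypic components. *)

(* Defs.v *)
From HB Require Import structures.
From mathcomp Require Import all_boot all_order all_algebra all_fingroup.
From mathcomp Require Import mxrepresentation.
From mathcomp Require Import all_classical all_reals all_analysis.
Set Implicit Arguments.
Unset Strict Implicit.
Unset Printing Implicit Defensive.
Import Order.TTheory GRing.Theory Num.Theory numFieldNormedType.Exports.
Local Open Scope ring_scope.
Local Open Scope classical_set_scope.

Definition mx2 {T : pzRingType} (a b c d : T) : 'M[T]_2 :=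
  \matrix_(i < 2, j < 2)
    if (i : nat) == 0%N then (if (j : nat) == 0%N then a else b)
    else (if (j : nat) == 0%N then c else d).

Definition rot {R : realType} (th : R) : 'M[R]_2 := mx2 (cos th) (- sin th) (sin th) (cos th).
(* reflection in the line through the origin with angle th/2 *)
Definition refl {R : realType} (th : R) : 'M[R]_2 := mx2 (cos th) (sin th) (sin th) (- cos th).

Definition segment {R : realType} (a b : 'cV[R]_2) : set 'cV[R]_2 :=
  [set x | exists2 t : R, 0 <= t <= 1 & x = (1 - t) *: a + t *: b].

Definition rot_m {R : realType} (m : nat) (i : nat) : 'M[R]_2 :=
  rot (2 * pi * i%:R / m%:R).

Definition standard_rep {R : realType} {gT : finGroupType} (G : {group gT})
    (tau : gT -> 'M[R]_2) (m : nat) : Prop :=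
  [/\ (0 < m)%N,
      {in G &, forall g h, tau (g * h)%g = tau g *m tau h},
      {in G &, injective tau} &
      (forall M, (exists2 g, g \in G & tau g = M) <->
                 (exists i : 'I_m, M = rot_m m i))
      \/
      (exists th : R, forall M, (exists2 g, g \in G & tau g = M) <->
                 (exists i : 'I_m, M = rot_m m i \/ M = rot_m m i *m refl th))].

Section Drawing.
Variables (R : realType) (V E : finType) (tl hd : E -> V) (p : V -> 'cV[R]_2).

Definition segE (e : E) : set 'cV[R]_2 := segment (p (tl e)) (p (hd e)).

Definition drawing : set 'cV[R]_2 :=
  [set x | exists v, x = p v] `|` \bigcup_(e in setT) segE e.

Definition planar_embedding : Prop :=
  [/\ injective p,
      (forall e, p (tl e) != p (hd e)),
      (forall e v, segE e (p v) -> v = tl e \/ v = hd e) &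
      (forall e e', e != e' -> forall x, segE e x -> segE e' x ->
           exists2 v, (v = tl e \/ v = hd e) /\ (v = tl e' \/ v = hd e') & x = p v)].

Variables (F : finType) (face : F -> set 'cV[R]_2).

Definition faces_of_drawing : Prop :=
  [/\ (forall f, exists2 x, ~ drawing x & face f = connected_component (~` drawing) x),
      (forall x, ~ drawing x -> exists f, face f x) &
      injective face].

(* X is a regular cell complex: the boundary of every face is a simple cycle
   of the graph (so the closure of each 2-cell is a closed disk on the sphere) *)
Definition regular_faces : Prop :=
  forall f, exists (n : nat) (c : 'I_n.+3 -> V),
    [/\ injective c,
        (forall i, exists e, (tl e = c i /\ hd e = c (ordS i)) \/
                             (tl e = c (ordS i) /\ hd e = c i)) &
        closure (face f) `\` face f =
          \bigcup_(i in setT) segment (p (c i)) (p (c (ordS i)))].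

(* Orientation of faces consistently with the (counterclockwise) orientation
   of the plane/sphere: [e:f] = +1 if f lies to the left of the oriented edge
   tl e -> hd e, -1 if it lies to the right, 0 if e is not on f. *)
Definition midE (e : E) : 'cV[R]_2 := 2^-1 *: (p (tl e) + p (hd e)).
Definition leftnormal (e : E) : 'cV[R]_2 := mx2 0 (-1) 1 0 *m (p (hd e) - p (tl e)).

Definition left_of (e : E) (f : F) : Prop :=
  exists2 eps : R, 0 < eps & forall t, 0 < t < eps -> face f (midE e + t *: leftnormal e).
Definition right_of (e : E) (f : F) : Prop :=
  exists2 eps : R, 0 < eps & forall t, 0 < t < eps -> face f (midE e - t *: leftnormal e).

Definition incEF (e : E) (f : F) : int :=
  if `[< left_of e f >] then 1 else if `[< right_of e f >] then -1 else 0.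

End Drawing.

Definition incVE {V E : finType} (tl hd : E -> V) (v : V) (e : E) : int :=
  if v == hd e then 1 else if v == tl e then -1 else 0.

Definition other_end {V E : finType} (tl hd : E -> V) (v : V) (e : E) : V :=
  if v == hd e then tl e else hd e.

Definition G_action {R : realType} {gT : finGroupType} (G : {group gT})
    (tau : gT -> 'M[R]_2) {V E F : finType} (tl hd : E -> V) (p : V -> 'cV[R]_2)
    (face : F -> set 'cV[R]_2)
    (aV : gT -> V -> V) (aE : gT -> E -> E) (aF : gT -> F -> F) : Prop :=
  [/\ [/\ {in G &, forall g h, aV (g * h)%g =1 aV g \o aV h} /\ aV 1%g =1 id,
          {in G &, forall g h, aE (g * h)%g =1 aE g \o aE h} /\ aE 1%g =1 id &
          {in G &, forall g h, aF (g * h)%g =1 aF g \o aF h} /\ aF 1%g =1 id],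
      (forall g, g \in G -> forall v, p (aV g v) = tau g *m p v),
      (forall g, g \in G -> forall e,
          (tl (aE g e) = aV g (tl e) /\ hd (aE g e) = aV g (hd e)) \/
          (tl (aE g e) = aV g (hd e) /\ hd (aE g e) = aV g (tl e))) &
      (forall g, g \in G -> forall f, face (aF g f) = (fun x => tau g *m x) @` face f)].

Definition k_is_R_or_C {R : realType} {k : fieldType} (iota : {rmorphism R -> k}) : Prop :=
  (forall z : k, exists a : R, z = iota a) \/
  (exists j : k, j ^+ 2 = -1 /\ forall z : k, exists a b : R, z = iota a + iota b * j).

(* C_2 of the constant cosheaf k^2 and C_2 of P coincide: P_f = k^2/0 = k^2; *)
(* both are {ffun F -> 'cV[k]_2}, and pi_f is the identity.                 *)
(* C_1 F = k^E.                                                             *)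

Section Cosheaves.
Variables (R : realType) (k : fieldType) (iota : {rmorphism R -> k}).
Variables (gT : finGroupType) (G : {group gT}) (tau : gT -> 'M[R]_2).
Variables (V E F : finType) (tl hd : E -> V) (p : V -> 'cV[R]_2) (face : F -> set 'cV[R]_2).
Variables (aV : gT -> V -> V) (aE : gT -> E -> E) (aF : gT -> F -> F).

Definition pk (v : V) : 'cV[k]_2 := map_mx iota (p v).
Definition tauk (g : gT) : 'M[k]_2 := map_mx iota (tau g).

(* extension map F_{e |> v}(1) = [v:e](p_v - p_u), u the other endpoint *)
Definition Fext (v : V) (e : E) : 'cV[k]_2 :=
  (incVE tl hd v e)%:~R *: (pk v - pk (other_end tl hd v e)).

(* phi_e(1) = [v:e](p_v - p_u) (independent of the endpoint v); we use v = hd e *)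
Definition phiE (e : E) : 'cV[k]_2 := Fext (hd e) e.

Definition bd2const (xi : {ffun F -> 'cV[k]_2}) (e : E) : 'cV[k]_2 :=
  \sum_(f : F) (incEF tl hd p face e f)%:~R *: xi f.

(* H_2 P = ker d_2 on C_2 P (C_3 = 0): xi is a reciprocal diagram, i.e.
   (d xi)_e = 0 in P_e = k^2 / span(phi_e(1)) *)
Definition H2P (xi : {ffun F -> 'cV[k]_2}) : Prop :=
  forall e, exists c : k, bd2const xi e = c *: phiE e.

(* H_1 F = ker d_1 on C_1 F (C_2 F = 0): self-stresses *)
Definition H1F (w : {ffun E -> k^o}) : Prop :=
  forall v, \sum_(e : E) (incVE tl hd v e)%:~R *: (w e *: Fext v e) = 0.

Definition Tconst (xi : {ffun F -> 'cV[k]_2}) : Prop :=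
  exists a : 'cV[k]_2, forall f, xi f = a.

(* phi_e^{-1} on its image span(d) *)
Definition phi_inv (d s : 'cV[k]_2) : k :=
  if d 0 0 != 0 then s 0 0 / d 0 0 else s 1 0 / d 1 0.

Definition theta (xi : {ffun F -> 'cV[k]_2}) : {ffun E -> k^o} :=
  [ffun e => phi_inv (phiE e) (bd2const xi e)].

(* induced actions on chains:
   constant cosheaf / P on faces: eta_f(g) = [gf,f] tau(g), [gf,f] = det tau(g)
   (+1 for rotations, -1 for reflections);  F on edges: rho_e(g) = 1. *)
Definition actC2 (g : gT) (xi : {ffun F -> 'cV[k]_2}) : {ffun F -> 'cV[k]_2} :=
  [ffun f => \det (tauk g) *: (tauk g *m xi (aF (g^-1)%g f))].

Definition actC1F (g : gT) (w : {ffun E -> k^o}) : {ffun E -> k^o} :=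
  [ffun e => w (aE (g^-1)%g e)].

End Cosheaves.

(* Isotypic components.  A kG-module is a subset M of an lmodType W stable   *)
(* under a linear action act.  For an irreducible representation            *)
(* rG : G -> GL_n(k) (acting on column vectors), M^(rG) is the sum of all    *)
(* submodules of M isomorphic to rG, i.e. the set of finite sums of elements *)
(* of images of injective k-linear G-equivariant maps 'cV_n -> M.           *)

Definition isotypic {k : fieldType} {gT : finGroupType} {G : {group gT}} {n : nat}
    (rG : mx_representation k G n) {W : lmodType k} (act : gT -> W -> W)
    (M : W -> Prop) (x : W) : Prop :=
  exists (N : nat) (fs : 'I_N -> {linear 'cV[k]_n -> W}) (ys : 'I_N -> 'cV[k]_n),
    (forall i, [/\ injective (fs i),
                   (forall y, M (fs i y)) &
                   (forall g, g \in G -> forall y, fs i (rG g *m y) = act g (fs i y))])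
    /\ x = \sum_(i < N) fs i (ys i).

(* Main.v *)
Require Import Defs.
From HB Require Import structures.
From mathcomp Require Import all_boot all_order all_algebra all_fingroup.
From mathcomp Require Import mxrepresentation.
From mathcomp Require Import all_classical all_reals all_analysis.
From mathcomp Require Import zify ring lra.
Import Order.TTheory GRing.Theory Num.Theory numFieldNormedType.Exports.
Local Open Scope ring_scope.
Local Open Scope classical_set_scope.
Set Implicit Arguments.
Unset Strict Implicit.

(** The long exact sequence is made explicit. An A-valued flow a on the edges
    has a potential on the complement of the drawing, namely the sum of a over
    the edges crossed (with sign) by the horizontal ray going right from x:
    conservation at the vertices makes it locally constant, and it jumps by a_e
    across e. Applied to w_e (p_u - p_v) for a self-stress w, this yields a
    reciprocal diagram over w; applied to the unit flow around the boundary cycle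
    of a face, it shows that the two sides of an edge are distinct faces.
    Conversely, following a function that is constant on faces around a vertex,
    its jumps add up to 0, so the boundary of a reciprocal diagram is a
    self-stress; following it along a segment that avoids the vertices, a function
    without jumps is constant. The isotypic statements follow since all maps are
    equivariant and kG is semisimple: Schur's lemma for images, Maschke averaging
    for lifts, and averaging over the faces as an equivariant projection onto the
    constant chains. *)

(** The delicate point of the ray potential is a ray through a vertex: there the crossing number of
    a single edge is not locally constant. The remedy is homological. Near a point of the complement
    this number is a constant plus the coboundary of a function of the vertices, and near an
    interior point of the edge one more term appears, the indicator of the left side; a conserved
    flow pairs to zero with coboundaries, so only the constants and the indicators survive in the
    sum. No Jordan curve theorem is needed: the two sides of an edge are told apart by a ray sum
    with value plus or minus one on that edge. This matters because [incEF] tests the left side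
    before the right and would hide a face lying on both. Equivariance comes down to two independent
    signs, whether [g] reverses the plane and whether it reverses the chosen direction of the edge.
    Sides are exchanged when exactly one of them is negative. *)

Lemma sum_I2 (T : nmodType) (f : 'I_2 -> T) : \sum_i f i = f 0 + f 1.
Proof.
rewrite !big_ord_recl big_ord0 addr0; congr (f _ + f _); exact: val_inj.
Qed.

Lemma mx22P (T : pzRingType) (A B : 'M[T]_2) : A 0 0 = B 0 0 -> A 0 1 = B 0 1 -> A 1 0 = B 1 0 ->
  A 1 1 = B 1 1 -> A = B.
Proof.
have I2 (i : 'I_2) : i = 0 \/ i = 1.
  by case: i => -[|[|//]] hi; [left|right]; apply: val_inj.
by move=> h1 h2 h3 h4; apply/matrixP => i j; case: (I2 i) => ->; case: (I2 j) => ->.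
Qed.

Lemma det_mx22 (T : comPzRingType) (A : 'M[T]_2) : \det A = A 0 0 * A 1 1 - A 0 1 * A 1 0.
Proof.
have l0 : lift (0 : 'I_2) (0 : 'I_1) = 1 by apply: val_inj.
have l1 : lift (1 : 'I_2) (0 : 'I_1) = 0 by apply: val_inj.
rewrite (expand_det_row _ 0) sum_I2 /cofactor !det_mx11 !mxE l0 l1 /=.
by rewrite addn0 add0n expr0 expr1 mul1r mulN1r mulrN.
Qed.

(** Local constancy of [W] along [K] makes its trace on [K] both relatively open and relatively
    closed. Every passage from local to global (along an edge, a face or a segment) goes through
    this lemma. *)
Lemma clopen_connected (T : topologicalType) (K W : set T) : connected K ->
  (forall x, K x -> \forall y \near x, K y -> (W y <-> W x)) ->
  forall x y, K x -> K y -> W x -> W y.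
Proof.
move=> cK h x y Kx Ky Wx.
have e : K `&` W = K.
  apply: cK; first by exists x.
  - exists (interior [set y | K y -> W y]); first exact: open_interior.
    apply/seteqP; split=> z.
      move=> [Kz Wz]; split=> //; have := h z Kz.
      by rewrite /interior; apply: filterS => w hw /hw[_ /(_ Wz)].
    by move=> [Kz /interior_subset/(_ Kz)].
  - exists (~` interior [set y | K y -> ~ W y]).
      by rewrite closedC; exact: open_interior.
    apply/seteqP; split=> z.
      by move=> [Kz Wz]; split=> // /interior_subset/(_ Kz).
    move=> [Kz nz]; split=> //; apply: contrapT => nW; apply: nz.
    by have := h z Kz; rewrite /interior; apply: filterS => w hw /hw[hh _] /hh.
by move: Ky; rewrite -{1}e => -[].
Qed.

(** * Plane geometry: sides of lines, segments, small displacements *)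

Section Plane.
Variable R : realType.
Implicit Types a b x y z d : 'cV[R]_2.

Lemma cV2P x y : x 0 0 = y 0 0 -> x 1 0 = y 1 0 -> x = y.
Proof.
move=> h0 h1; apply/matrixP => i j; rewrite (ord1 j).
case: i => -[|[|//]] hi.
- by rewrite (_ : Ordinal hi = 0) //; apply: val_inj.
- by rewrite (_ : Ordinal hi = 1) //; apply: val_inj.
Qed.

Definition cross d x : R := d 0 0 * x 1 0 - d 1 0 * x 0 0.
Definition dot d x : R := d 0 0 * x 0 0 + d 1 0 * x 1 0.
(** Twice the signed area of the triangle [a], [b], [x], hence positive when [x] lies to the left of
    the line directed from [a] to [b]. *)
Definition side a b x : R := cross (b - a) (x - a).

Lemma sideE a b x :
  side a b x = (b 0 0 - a 0 0) * (x 1 0 - a 1 0) - (b 1 0 - a 1 0) * (x 0 0 - a 0 0).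
Proof. by rewrite /side /cross !mxE. Qed.

Lemma sideC a b x : side b a x = - side a b x.
Proof. rewrite !sideE; ring. Qed.

Lemma segmentC a b : segment a b = segment b a.
Proof.
apply/seteqP; split => x [t /andP[t0 t1] ->]; exists (1 - t).
- by apply/andP; split; lra.
- by apply: cV2P; rewrite !mxE; ring.
- by apply/andP; split; lra.
- by apply: cV2P; rewrite !mxE; ring.
Qed.

Lemma segment_left a b : segment a b a.
Proof. by exists 0; [rewrite lexx ler01|rewrite subr0 scale1r scale0r addr0]. Qed.

Lemma segment_right a b : segment a b b.
Proof. by rewrite segmentC; exact: segment_left. Qed.

Lemma segment_side a b x : segment a b x -> side a b x = 0.
Proof. by move=> [t _ ->]; rewrite sideE !mxE; ring. Qed.

Lemma dot_gt0 d : d != 0 -> 0 < dot d d.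
Proof.
move=> d0; rewrite /dot; suff: d 0 0 != 0 \/ d 1 0 != 0.
  by move=> [h|h]; [have := h|have := h]; rewrite neq_lt => /orP[] ?; nra.
apply: contrapT => /not_orP[/negP/negPn/eqP h0 /negP/negPn/eqP h1].
by move/eqP: d0; apply; apply: cV2P; rewrite mxE.
Qed.

Lemma line_coord (u v p q t : R) : u * u + v * v != 0 -> u * q - v * p = 0 ->
  t * (u * u + v * v) = u * p + v * q -> p = t * u /\ q = t * v.
Proof.
move=> dn /eqP; rewrite subr_eq0 => /eqP h ht; split; apply: (mulIf dn).
- by rewrite mulrAC ht mulrDl mulrDr -[v * q * u]mulrA [q * u]mulrC h; ring.
- by rewrite mulrAC ht mulrDl mulrDr -[u * p * v]mulrA [p * v]mulrC -h; ring.
Qed.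

Lemma segment_dot a b x : a != b -> side a b x = 0 ->
  0 <= dot (b - a) (x - a) <= dot (b - a) (b - a) -> segment a b x.
Proof.
move=> ab sx /andP[h0 h1].
have dp : 0 < dot (b - a) (b - a) by apply: dot_gt0; rewrite subr_eq0 eq_sym.
exists (dot (b - a) (x - a) / dot (b - a) (b - a)).
  by rewrite divr_ge0 ?(ltW dp) //= ler_pdivrMr // mul1r.
have dn : dot (b - a) (b - a) != 0 by rewrite gt_eqF.
have [] := @line_coord ((b - a) 0 0) ((b - a) 1 0) ((x - a) 0 0) ((x - a) 1 0)
  (dot (b - a) (x - a) / dot (b - a) (b - a)).
- by rewrite -[X in X != _]/(dot _ _).
- by [].
- by rewrite -[X in _ / X]/(dot _ _) divfK.
rewrite !mxE => h2 h3; apply: cV2P; rewrite !mxE.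
- by rewrite mulrBl mul1r addrAC -addrA -mulrBr -h2 addrC subrK.
- by rewrite mulrBl mul1r addrAC -addrA -mulrBr -h3 addrC subrK.
Qed.

Lemma coordB_continuous (i : 'I_2) : continuous (fun x : 'cV[R]_2 => x i 0).
Proof. exact: coord_continuous. Qed.

Lemma continuous_affine (T : topologicalType) (f g : T -> R) (u v w : R) :
  continuous f -> continuous g -> continuous (fun t => u * f t + v * g t + w).
Proof.
move=> cf cg t; apply: cvgD; last exact: cvg_cst.
by apply: cvgD; apply: cvgMl_tmp; [exact: cf|exact: cg].
Qed.

Lemma affine_continuous (u v w : R) :
  continuous (fun x : 'cV[R]_2 => u * x 0 0 + v * x 1 0 + w).
Proof. by apply: continuous_affine; exact: coordB_continuous. Qed.

Lemma side_continuous a b : continuous (side a b).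
Proof.
rewrite (_ : side a b = fun x => (- (b 1 0 - a 1 0)) * x 0 0 + (b 0 0 - a 0 0) * x 1 0
   + ((b 1 0 - a 1 0) * a 0 0 - (b 0 0 - a 0 0) * a 1 0)); first exact: affine_continuous.
by apply/funext => x; rewrite sideE; ring.
Qed.

Lemma dot_continuous d a : continuous (fun x => dot d (x - a)).
Proof.
rewrite (_ : (fun x => _) = fun x => d 0 0 * x 0 0 + d 1 0 * x 1 0
   + (- d 0 0 * a 0 0 - d 1 0 * a 1 0)); first exact: affine_continuous.
by apply/funext => x; rewrite /dot !mxE; ring.
Qed.

Lemma near_gt (T : topologicalType) (f : T -> R) (c : R) (t : T) : continuous f -> c < f t -> \forall y \near t, c < f y.
Proof. by move=> cf h; apply: (cvgr_gt (f t)) => //; exact: cf. Qed.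

Lemma near_lt (T : topologicalType) (f : T -> R) (c : R) (t : T) : continuous f -> f t < c -> \forall y \near t, f y < c.
Proof. by move=> cf h; apply: (cvgr_lt (f t)) => //; exact: cf. Qed.

Lemma line_continuous a b : continuous (fun t : R => (1 - t) *: a + t *: b : 'cV[R]_2).
Proof.
move=> t; apply: cvgD; apply: cvgZr_tmp; last exact: cvg_id.
by apply: cvgB; [exact: cvg_cst|exact: cvg_id].
Qed.

Lemma segmentE a b : segment a b = (fun t : R => (1 - t) *: a + t *: b) @` `[0, 1].
Proof.
apply/seteqP; split=> x.
  by move=> [t ht ->]; exists t => //=; rewrite in_itv.
by move=> [t /=]; rewrite in_itv /= => ht <-; exists t.
Qed.

Lemma segment_closed a b : closed (segment a b).
Proof.
rewrite segmentE; apply: compact_closed; first exact: norm_hausdorff.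
apply: continuous_compact; last exact: segment_compact.
by apply: continuous_subspaceT; exact: line_continuous.
Qed.

Lemma connected_segment a b : connected (segment a b).
Proof.
rewrite segmentE; apply: connected_continuous_connected; first exact: segment_connected.
by apply: continuous_subspaceT; exact: line_continuous.
Qed.

Lemma near_off_segment a b x : ~ segment a b x -> \forall y \near x, ~ segment a b y.
Proof.
move=> h; apply: (@open_nbhs_nbhs _ x (~` segment a b)); split => //.
by rewrite openC; exact: segment_closed.
Qed.

Lemma ball_segment x (eps : R) a b : ball x eps a -> ball x eps b ->
  forall y, segment a b y -> ball x eps y.
Proof.
move=> ha hb y [t /andP[t0 t1] ->]; move: ha hb.
rewrite -!ball_normE /ball_ /= => ha hb.
have -> : x - ((1 - t) *: a + t *: b) = (1 - t) *: (x - a) + t *: (x - b).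
  by apply: cV2P; rewrite !mxE; ring.
apply: le_lt_trans (ler_normD _ _) _; rewrite !normrZ (ger0_norm t0) ger0_norm ?subr_ge0//.
have [->|tn] := eqVneq t 0; first by rewrite mul0r subr0 mul1r addr0.
have : 0 < t by rewrite lt_def tn.
by move: ha hb; set A := `|x - a|; set B := `|x - b| => *; nra.
Qed.

Lemma near_ball x (P : 'cV[R]_2 -> Prop) : (\forall y \near x, P y) ->
  exists2 eps : R, 0 < eps & forall y, ball x eps y -> P y.
Proof. by move=> /nbhs_ballP[eps /= e0 h]; exists eps. Qed.

Lemma near_forall (T : topologicalType) (I : finType) (P : I -> T -> Prop) (t : T) :
  (forall i, \forall u \near t, P i u) -> \forall u \near t, forall i, P i u.
Proof. by move=> h; exact: (filter_forall (nbhs_filter t) h). Qed.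

Lemma near_always (T : topologicalType) (P : T -> Prop) (t : T) :
  (forall u, P u) -> \forall u \near t, P u.
Proof. by move=> h; exact: nearW. Qed.

Lemma near_path x d (P : 'cV[R]_2 -> Prop) : (\forall y \near x, P y) ->
  exists2 eps : R, 0 < eps & forall t, 0 <= t < eps -> P (x + t *: d).
Proof.
move=> h.
have : \forall t \near (0 : R), P (x + t *: d).
  have c : (fun t : R => x + t *: d) @ (0 : R) --> x + (0 : R) *: d.
    by apply: cvgD; [exact: cvg_cst|apply: cvgZr_tmp; exact: cvg_id].
  by rewrite scale0r addr0 in c; exact: c h.
move=> /nbhs_ballP[eps /= e0 H]; exists eps => // t /andP[t0 t1].
by apply: H; rewrite -ball_normE /ball_ /= sub0r normrN ger0_norm.
Qed.

(** The genericity device: a small parameter can be chosen so that a segment misses all vertices, or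
    a direction differs from those of all edges. *)
Lemma finite_avoid (s : seq R) : exists2 eps : R, 0 < eps & forall t, 0 < t < eps -> t \notin s.
Proof.
elim: s => [|r s [eps e0 IH]]; first by exists 1.
have [r0|r0] := ltP 0 r.
  exists (Num.min r eps); first by rewrite lt_min r0.
  move=> t; rewrite lt_min => /and3P[t0 tr te].
  by rewrite inE negb_or lt_eqF //= IH // t0.
exists eps => // t /andP[t0 te]; rewrite inE negb_or IH ?t0 // andbT gt_eqF //.
exact: le_lt_trans t0.
Qed.

End Plane.

(** * Crossings of a horizontal ray *)

Section RayCrossing.
Variable R : realType.
Implicit Types a b x y : 'cV[R]_2.

Lemma segment_height a b x : a 1 0 != b 1 0 -> side a b x = 0 ->
  a 1 0 <= x 1 0 <= b 1 0 -> segment a b x.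
Proof.
move=> ab; rewrite sideE => sx /andP[h0 h1].
have lt : 0 < b 1 0 - a 1 0 by rewrite subr_gt0 lt_neqAle ab (le_trans h0 h1).
have dn : b 1 0 - a 1 0 != 0 by rewrite gt_eqF.
exists ((x 1 0 - a 1 0) / (b 1 0 - a 1 0)).
  rewrite divr_ge0 ?(ltW lt) ?subr_ge0 //= ler_pdivrMr // mul1r; lra.
apply: cV2P; rewrite !mxE; last by field.
apply: (mulIf dn); rewrite mulrDl.
have -> : (x 1 0 - a 1 0) / (b 1 0 - a 1 0) * b 0 0 * (b 1 0 - a 1 0) = (x 1 0 - a 1 0) * b 0 0 by field.
have -> : (1 - (x 1 0 - a 1 0) / (b 1 0 - a 1 0)) * a 0 0 * (b 1 0 - a 1 0) = (b 1 0 - x 1 0) * a 0 0 by field.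
lra.
Qed.

Lemma segment_horizontal a b x : a 1 0 = x 1 0 -> b 1 0 = x 1 0 ->
  a 0 0 <= x 0 0 <= b 0 0 -> segment a b x.
Proof.
move=> h0 h1 /andP[h2 h3]; have [e|ab] := eqVneq a b.
  rewrite (_ : x = a); first exact: segment_left.
  by apply: cV2P; rewrite ?h0 //; move: h2 h3; rewrite e; lra.
apply: segment_dot => //; first by rewrite sideE h0 h1; ring.
rewrite /dot !mxE h0 h1; apply/andP; split; nra.
Qed.

Definition above a x : bool := x 1 0 < a 1 0.

(* Signed crossing of the edge a -> b with the horizontal ray going right from
   x; counting b as crossed only when it lies strictly above x makes the
   crossings of all edges at a vertex change simultaneously. *)
Definition crossing a b x : int :=
  [&& above b x, ~~ above a x & 0 < side a b x]%:R -
  [&& above a x, ~~ above b x & side a b x < 0]%:R.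

Definition rightof x a : bool := x 0 0 < a 0 0.

Lemma crossingC a b x : crossing b a x = - crossing a b x.
Proof. by rewrite /crossing sideC oppr_gt0 oppr_lt0 opprB. Qed.

Lemma near_above a x : a 1 0 != x 1 0 -> \forall y \near x, above a y = above a x.
Proof.
rewrite /above neq_lt => /orP[h|h].
- have := near_gt (@coordB_continuous R 1) h; apply: filterS => y /= hy.
  by rewrite !ltNge (ltW h) (ltW hy).
- have := near_lt (@coordB_continuous R 1) h; apply: filterS => y /= hy.
  by rewrite h hy.
Qed.

Lemma near_side a b x : side a b x != 0 -> \forall y \near x,
  ((0 < side a b y) = (0 < side a b x)) /\ ((side a b y < 0) = (side a b x < 0)).
Proof.
rewrite neq_lt => /orP[h|h].
- have := near_lt (@side_continuous R a b) h; apply: filterS => y /= hy.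
  by rewrite h hy !ltNge (ltW h) (ltW hy).
- have := near_gt (@side_continuous R a b) h; apply: filterS => y /= hy.
  by rewrite h hy !ltNge (ltW h) (ltW hy).
Qed.

(** The crossing number minus a difference of vertex terms. In these terms the height test follows
    the moving point [y], while [rightof] stays frozen at [x]; the jumps that occur when [y] passes
    the height of an endpoint then cancel. *)
Let reduced a b x y : int :=
  crossing a b y - ((above b y && rightof x b)%:R - (above a y && rightof x a)%:R).

Let reducedC a b x y : reduced b a x y = - reduced a b x y.
Proof. by rewrite /reduced crossingC !opprB addrC. Qed.

Lemma crossing_off_segment a b x : ~ segment a b x -> exists c : int, \forall y \near x,
  crossing a b y = (above b y && rightof x b)%:R - (above a y && rightof x a)%:R + c.
Proof.
move=> nab; suff [c hc] : exists c, \forall y \near x, reduced a b x y = c.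
  by exists c; move: hc; apply: filterS => y <-; rewrite /reduced addrC subrK.
(* The case of exactly one endpoint at the height of [x]: since [x] differs from [b'], being left or
   right of [b'] decides the sign of [side a' b'] near [x]. *)
have key a' b' : ~ segment a' b' x -> a' 1 0 != x 1 0 -> b' 1 0 = x 1 0 ->
    exists c, \forall y \near x, reduced a' b' x y = c.
  move=> {nab}nab ha hb.
  have sx : side a' b' x = (x 1 0 - a' 1 0) * (b' 0 0 - x 0 0) by rewrite sideE hb; ring.
  have bx : b' 0 0 - x 0 0 != 0.
    apply: contra_not_neq nab => h; rewrite (_ : x = b'); first exact: segment_right.
    by apply: cV2P; rewrite // (subr0_eq h).
  have s0 : side a' b' x != 0 by rewrite sx mulf_neq0 // subr_eq0 eq_sym.
  have := near_side s0; have := near_above ha.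
  have [hab|hab] := ltP (a' 1 0) (x 1 0).
    have A : above a' x = false by rewrite /above ltNge (ltW hab).
    have B : (0 < side a' b' x) = rightof x b'.
      by rewrite sx pmulr_rgt0 ?subr_gt0.
    move=> h1 h2; exists 0; near=> y; rewrite /reduced /crossing.
    have [-> ->] : (0 < side a' b' y) = (0 < side a' b' x) /\ (side a' b' y < 0) = (side a' b' x < 0) by near: y.
    have -> : above a' y = above a' x by near: y.
    by rewrite A B /= !subr0 subrr.
  have {}hab : x 1 0 < a' 1 0 by rewrite lt_neqAle eq_sym ha.
  have A : above a' x by [].
  have B : (side a' b' x < 0) = rightof x b'.
    by rewrite sx nmulr_rlt0 ?subr_lt0 // subr_gt0.
  move=> h1 h2; exists ((rightof x a')%:R - (rightof x b')%:R); near=> y; rewrite /reduced /crossing.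
  have [-> ->] : (0 < side a' b' y) = (0 < side a' b' x) /\ (side a' b' y < 0) = (side a' b' x < 0) by near: y.
  have -> : above a' y = above a' x by near: y.
  by rewrite A B; case: (above b' y); case: (rightof x b'); case: (rightof x a').
have [hb|hb] := eqVneq (b 1 0) (x 1 0); have [ha|ha] := eqVneq (a 1 0) (x 1 0).
(* A horizontal edge at the height of [x] has no crossings; as [x] is off it, both ends lie on the
   same side of [x] and the vertex terms cancel. *)
- exists 0; near=> y; rewrite /reduced /crossing /above ha hb.
  suff -> : rightof x a = rightof x b by case: (_ < _) => /=; rewrite ?andbF !subrr.
  rewrite /rightof; apply/idP/idP => h; rewrite ltNge; apply/negP => h'; apply: nab.
  + by rewrite segmentC; apply: segment_horizontal => //; rewrite h' ltW.
  + by apply: segment_horizontal => //; rewrite h' ltW.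
- exact: key.
- have [|c hc] := key b a _ hb ha; first by rewrite segmentC.
  by exists (- c); move: hc; apply: filterS => y; rewrite reducedC => <-; rewrite opprK.
- have := near_above ha; have := near_above hb => h1 h2.
  have [e|e] := eqVneq (above b x) (above a x).
    exists (- ((above b x && rightof x b)%:R - (above a x && rightof x a)%:R)).
    near=> y; rewrite /reduced /crossing.
    have -> : above a y = above a x by near: y.
    have -> : above b y = above b x by near: y.
    by rewrite e; case: (above a x) => /=; rewrite ?andbF ?subrr ?sub0r ?oppr0.
  (* The endpoints are on opposite sides of the height of [x], so a point on their line at that
     height would lie on the segment. *)
  have s0 : side a b x != 0.
    apply: contra_not_neq nab => s; move: e ha hb; rewrite /above.
    case: ltgtP => // h; case: ltgtP => // h' _ _ _.
    - by apply: segment_height => //; [rewrite lt_eqF // (lt_trans h')|rewrite !ltW].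
    - rewrite segmentC; apply: segment_height => //; last by rewrite !ltW.
        by rewrite lt_eqF // (lt_trans h).
      by rewrite sideC s oppr0.
  have h3 := near_side s0; exists (reduced a b x x).
  near=> y; rewrite /reduced /crossing.
  have [-> ->] : (0 < side a b y) = (0 < side a b x) /\ (side a b y < 0) = (side a b x < 0) by near: y.
  have -> : above a y = above a x by near: y.
  by have -> : above b y = above b x by near: y.
Unshelve. all: by end_near.
Qed.

(** The vertex terms are those of [crossing_off_segment], so that both formulas can be summed over
    all edges; the indicator of the left side is the unit jump across the edge. *)
Lemma crossing_on_segment a b x : segment a b x -> x != a -> x != b ->
  exists c : int, \forall y \near x, side a b y != 0 ->
  crossing a b y = (above b y && rightof x b)%:R - (above a y && rightof x a)%:R
                   + (0 < side a b y)%R%:R + c.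
Proof.
move=> [t /andP[t0 t1] ex] xa xb.
have {}t0 : 0 < t.
  rewrite lt_neqAle t0 andbT; apply: contra_neq xa => t'.
  by rewrite ex -t' subr0 scale1r scale0r addr0.
have {}t1 : t < 1.
  rewrite lt_neqAle t1 andbT; apply: contra_neq xb => t'.
  by rewrite ex t' subrr scale0r add0r scale1r.
have e0 : x 0 0 = (1 - t) * a 0 0 + t * b 0 0 by rewrite ex !mxE.
have e1 : x 1 0 = (1 - t) * a 1 0 + t * b 1 0 by rewrite ex !mxE.
have [h|h|h] := ltgtP (a 1 0) (b 1 0).
- have ha : a 1 0 < x 1 0 by nra.
  have hb : x 1 0 < b 1 0 by nra.
  have h1 := near_above (negbT (lt_eqF ha)); have h2 := near_above (negbT (gt_eqF hb)).
  exists (- (rightof x b)%:R); near=> y => s0; rewrite /crossing.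
  have -> : above a y = above a x by near: y.
  have -> : above b y = above b x by near: y.
  have [-> ->] : above b x = true /\ above a x = false by rewrite /above hb ltNge (ltW ha).
  by case: (rightof x b); case: (0 < side a b y).
- have ha : x 1 0 < a 1 0 by nra.
  have hb : b 1 0 < x 1 0 by nra.
  have h1 := near_above (negbT (gt_eqF ha)); have h2 := near_above (negbT (lt_eqF hb)).
  exists ((rightof x a)%:R - 1); near=> y => s0; rewrite /crossing.
  have -> : above a y = above a x by near: y.
  have -> : above b y = above b x by near: y.
  have [-> ->] : above a x = true /\ above b x = false by rewrite /above ha ltNge (ltW hb).
  by move: s0; case: ltgtP => // _ _; case: (rightof x a).
(* On a horizontal edge the crossing number is zero on both sides, and the vertex terms alone
   compensate the side indicator. *)
- have hx : x 1 0 = a 1 0 by rewrite e1 -h; ring.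
  exists (- (a 0 0 < b 0 0)%R%:R); near=> y => s0; rewrite /crossing.
  have sy : side a b y = (b 0 0 - a 0 0) * (y 1 0 - a 1 0) by rewrite sideE -h; ring.
  have ab : a 0 0 != b 0 0.
    by apply: contra_neq s0 => e; rewrite sy e subrr mul0r.
  move: s0; rewrite /above /rightof -h sy.
  have q0 : x 0 0 - a 0 0 = t * (b 0 0 - a 0 0) by rewrite e0; ring.
  have q1 : b 0 0 - x 0 0 = (1 - t) * (b 0 0 - a 0 0) by rewrite e0; ring.
  have u0 : 0 < 1 - t by rewrite subr_gt0.
  move: ab; rewrite neq_lt => /orP[ab|ab].
  + have -> : x 0 0 < b 0 0 by rewrite -subr_gt0 q1 mulr_gt0 // subr_gt0.
    have -> : (x 0 0 < a 0 0) = false.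
      by apply/negbTE; rewrite -leNgt -subr_ge0 q0 mulr_ge0 ?subr_ge0 // ltW.
    rewrite ab pmulr_rgt0 ?subr_gt0 // mulf_eq0 negb_or => /andP[_].
    by rewrite subr_eq0; case: (ltgtP (y 1 0)).
  + have -> : x 0 0 < a 0 0 by rewrite -subr_lt0 q0 pmulr_rlt0 // subr_lt0.
    have -> : (x 0 0 < b 0 0) = false.
      by apply/negbTE; rewrite -leNgt -subr_le0 q1 pmulr_rle0 // subr_le0 ltW.
    rewrite (lt_gtF ab) nmulr_rgt0 ?subr_lt0 // mulf_eq0 negb_or => /andP[_].
    by rewrite subr_eq0; case: (ltgtP (y 1 0)).
Unshelve. all: by end_near.
Qed.

End RayCrossing.

(** * Faces of a planar drawing *)

Section Faces.
Variables (R : realType) (V E F : finType) (tl hd : E -> V) (p : V -> 'cV[R]_2).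
Variable face : F -> set 'cV[R]_2.
Hypothesis Hemb : planar_embedding tl hd p.
Hypothesis Hfaces : faces_of_drawing tl hd p face.
Implicit Types (e : E) (f : F) (v : V) (x y z q : 'cV[R]_2).

Local Notation "'off' x" := (~ drawing tl hd p x) (at level 10, x at level 9).

Definition eside e x : R := side (p (tl e)) (p (hd e)) x.

Definition inner e q : Prop :=
  exists2 t : R, 0 < t < 1 & q = (1 - t) *: p (tl e) + t *: p (hd e).

Lemma inner_segE e q : inner e q -> segE tl hd p e q.
Proof. by move=> [t /andP[t0 t1] ->]; exists t => //; rewrite !ltW. Qed.

Lemma inner_vertex e q v : inner e q -> q != p v.
Proof.
move=> qi; apply/eqP => qv; have [_ Hne Hv _] := Hemb.
have := inner_segE qi; rewrite qv => /Hv; move: qi => [t /andP[t0 t1]].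
have d0 : p (hd e) - p (tl e) != 0 by rewrite subr_eq0 eq_sym.
rewrite qv => eq [] ev; move: eq; rewrite ev => eq.
- have : t *: (p (hd e) - p (tl e)) == 0.
    by apply/eqP; apply: cV2P; move: eq => /matrixP eq; have := eq 0 0;
      have := eq 1 0; rewrite !mxE; lra.
  by rewrite scaler_eq0 (negbTE d0) orbF gt_eqF.
- have : (1 - t) *: (p (hd e) - p (tl e)) == 0.
    by apply/eqP; apply: cV2P; move: eq => /matrixP eq; have := eq 0 0;
      have := eq 1 0; rewrite !mxE; lra.
  by rewrite scaler_eq0 (negbTE d0) orbF subr_eq0 gt_eqF.
Qed.

Lemma segE_inner e q : segE tl hd p e q -> (forall v, q <> p v) -> inner e q.
Proof.
move=> [t /andP[t0 t1] eq] nv; exists t => //; rewrite !lt_neqAle t0 t1 !andbT.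
apply/andP; split; apply/eqP => et.
- by apply: (nv (tl e)); rewrite eq -et subr0 scale1r scale0r addr0.
- by apply: (nv (hd e)); rewrite eq et subrr scale0r scale1r add0r.
Qed.

Lemma drawing_cases x : drawing tl hd p x -> (exists v, x = p v) \/ (exists e, inner e x).
Proof.
move=> dx; have [vx|nv] := pselect (exists v, x = p v); first by left.
right; case: dx => // -[e _ ex]; exists e; apply: segE_inner => // v xv.
by apply: nv; exists v.
Qed.

Lemma inner_other e e' q : inner e q -> e' != e -> ~ segE tl hd p e' q.
Proof.
move=> qi ne qe; have [_ _ _ Hx] := Hemb.
have [v _ qv] := Hx _ _ ne _ qe (inner_segE qi).
by have := inner_vertex v qi; rewrite qv eqxx.
Qed.

Lemma inner_drawing e q : inner e q -> drawing tl hd p q.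
Proof. by move=> qi; right; exists e => //; exact: inner_segE. Qed.

Lemma midE_inner e : inner e (midE tl hd p e).
Proof.
exists 2^-1; first by apply/andP; split; lra.
by apply: cV2P; rewrite /midE !mxE; field.
Qed.

Lemma near_off_vertex v x : x != p v -> \forall y \near x, y != p v.
Proof.
move=> xv; have : ~ segment (p v) (p v) x.
  by move=> [t _ ex]; move/eqP: xv; apply; rewrite ex -scalerDl subrK scale1r.
move=> /near_off_segment; apply: filterS => y hy; apply/eqP => ey; apply: hy.
by rewrite ey; exact: segment_left.
Qed.

Lemma near_off x : off x -> \forall y \near x, off y.
Proof.
move=> nx.
have h1 : \forall y \near x, forall v, y != p v.
  apply: (@near_forall _ _ (fun v y => y != p v)) => v; apply: near_off_vertex; apply/eqP => xv.
  by apply: nx; left; exists v.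
have h2 : \forall y \near x, forall e, ~ segE tl hd p e y.
  apply: (@near_forall _ _ (fun e y => ~ segE tl hd p e y)) => e; apply: near_off_segment => xe.
  by apply: nx; right; exists e.
near=> y => -[[v yv]|[e _ ye]].
- have H : forall v, y != p v by near: y.
  by have := H v; rewrite yv eqxx.
- have H : forall e, ~ segE tl hd p e y by near: y.
  exact: H ye.
Unshelve. all: by end_near.
Qed.

(** The vertices and the other edges are closed and miss [q], and the projection onto [e] stays
    strictly between its ends, so near [q] the drawing is just the line of [e]. *)
Lemma near_inner e q : inner e q -> \forall x \near q, off x <-> eside e x != 0.
Proof.
move=> qi; have [_ Hne _ _] := Hemb.
have h1 : \forall y \near q, forall v, y != p v.
  by apply: (@near_forall _ _ (fun v y => y != p v)) => v; apply: near_off_vertex; exact: inner_vertex _ qi.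
have h2 : \forall y \near q, forall e', e' != e -> ~ segE tl hd p e' y.
  apply: (@near_forall _ _ (fun e' y => e' != e -> ~ segE tl hd p e' y)) => e'; have [->|ne] := eqVneq e' e; first by apply: near_always => y /eqP.
  by have := near_off_segment (inner_other qi ne); apply: filterS => y.
have dp : 0 < dot (p (hd e) - p (tl e)) (p (hd e) - p (tl e)).
  by apply: dot_gt0; rewrite subr_eq0 eq_sym.
have eqd : exists2 t : R, 0 < t < 1 & dot (p (hd e) - p (tl e)) (q - p (tl e)) =
    t * dot (p (hd e) - p (tl e)) (p (hd e) - p (tl e)).
  by move: qi => [t t01 ->]; exists t => //; rewrite /dot !mxE; ring.
have [t /andP[t0 t1] ed] := eqd.
have h3 : \forall y \near q, 0 < dot (p (hd e) - p (tl e)) (y - p (tl e)).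
  by apply: near_gt; [exact: dot_continuous|rewrite ed mulr_gt0].
have h4 : \forall y \near q, dot (p (hd e) - p (tl e)) (y - p (tl e)) <
    dot (p (hd e) - p (tl e)) (p (hd e) - p (tl e)).
  by apply: near_lt; [exact: dot_continuous|rewrite ed gtr_pMl].
near=> y; split.
- move=> oy; apply/eqP => sy; apply: oy; right; exists e => //.
  apply: segment_dot => //; rewrite !ltW //; near: y; [exact: h4|exact: h3].
- move=> /eqP sy [[v yv]|[e' _ ye]].
    have H : forall v, y != p v by near: y.
    by have := H v; rewrite yv eqxx.
  have [ee|ne] := eqVneq e' e; first by apply: sy; rewrite -ee; exact: segment_side.
  have H : forall e', e' != e -> ~ segE tl hd p e' y by near: y.
  exact: H ne ye.
Unshelve. all: by end_near.
Qed.

Lemma face_off f x : face f x -> off x.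
Proof.
by have [H _ _] := Hfaces; have [x0 _ ->] := H f => /connected_component_sub.
Qed.

Lemma face_cover x : off x -> exists f, face f x.
Proof. by have [_ H _] := Hfaces; exact: H. Qed.

Lemma face_uniq f f' x : face f x -> face f' x -> f = f'.
Proof.
have [H _ inj] := Hfaces; move=> fx fx'; apply: inj; move: fx fx'.
have [x0 _ ->] := H f; have [x1 _ ->] := H f'.
have same y : connected_component (~` drawing tl hd p) y x ->
    connected_component (~` drawing tl hd p) y = connected_component (~` drawing tl hd p) x.
  exact: same_connected_component.
by move=> /same -> /same ->.
Qed.

Lemma face_connected f : connected (face f).
Proof.
by have [H _ _] := Hfaces; have [x0 _ ->] := H f; exact: component_connected.
Qed.

Lemma segment_face f x y : (forall z, segment x y z -> off z) -> face f x -> face f y.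
Proof.
have [H _ _] := Hfaces; have [x0 _ ->] := H f => h /same_connected_component ->.
apply: (@connected_component_max _ _ (segment x y)); last exact: segment_right.
- exact: segment_left.
- exact: h.
- exact: connected_segment.
Qed.

Lemma near_face f x : face f x -> \forall y \near x, face f y.
Proof.
move=> fx; have [eps e0 h] := near_ball (near_off (face_off fx)).
apply/nbhs_ballP; exists eps => //= y xy; apply: segment_face fx => z.
by move=> /(ball_segment (ballxx x e0) xy); exact: h.
Qed.

Lemma eside_normal e x (t : R) : eside e (x + t *: leftnormal tl hd p e) =
  eside e x + t * dot (p (hd e) - p (tl e)) (p (hd e) - p (tl e)).
Proof.
by rewrite /eside !sideE /leftnormal /dot !mxE !sum_I2 !mxE /=; ring.
Qed.

Lemma edot_gt0 e : 0 < dot (p (hd e) - p (tl e)) (p (hd e) - p (tl e)).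
Proof. by have [_ Hne _ _] := Hemb; apply: dot_gt0; rewrite subr_eq0 eq_sym. Qed.

Lemma inner_eside e q : inner e q -> eside e q = 0.
Proof. by move=> /inner_segE; exact: segment_side. Qed.

Lemma eside_shift_gt0 e q (s t : R) : inner e q -> s != 0 -> 0 < t ->
  0 < s * eside e (q + t *: (s *: leftnormal tl hd p e)).
Proof.
move=> qi s0 t0; rewrite scalerA eside_normal inner_eside // add0r.
have -> (D : R) : s * (t * s * D) = t * (s ^+ 2 * D) by ring.
by rewrite mulr_gt0 // mulr_gt0 ?edot_gt0 // lt_def sqrf_eq0 s0 sqr_ge0.
Qed.

Lemma near_half e q (s : R) (P : 'cV[R]_2 -> Prop) : inner e q -> s != 0 ->
  (\forall x \near q, P x) -> exists2 x, P x & 0 < s * eside e x.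
Proof.
move=> qi s0 /(near_path (s *: leftnormal tl hd p e))[eps e0 h].
exists (q + (eps / 2) *: (s *: leftnormal tl hd p e)); first by apply: h; apply/andP; split; lra.
by apply: eside_shift_gt0; rewrite ?divr_gt0.
Qed.

(** A small half-ball on one side of [e] is convex and misses the drawing, so one face contains
    it. *)
Lemma inner_half e q (s : R) : inner e q -> s != 0 ->
  exists f, \forall x \near q, 0 < s * eside e x -> face f x.
Proof.
move=> qi s0; have [eps e0 h] := near_ball (near_inner qi).
have bq : \forall x \near q, ball q eps x by apply/nbhs_ballP; exists eps.
have [x0 bx0 sx0] := near_half qi s0 bq.
have off_half x : ball q eps x -> 0 < s * eside e x -> off x.
  by move=> /h -> sx; apply: contraTneq sx => ->; rewrite mulr0 ltxx.
have [f fx0] := face_cover (off_half _ bx0 sx0); exists f.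
apply: filterS bq => x bx sx; apply: segment_face fx0 => z xz.
apply: off_half; first exact: ball_segment bx0 bx _ xz.
move: xz sx0 sx => [t /andP[t0 t1] ->]; rewrite /eside !sideE !mxE.
have [->|tn] := eqVneq t 0; first by rewrite !subr0 !mul1r !mul0r !addr0.
have {}t0 : 0 < t by rewrite lt_def tn.
set A := s * _; set B := s * _; set C := s * _ => A0 B0.
have -> : C = (1 - t) * A + t * B by rewrite /A /B /C; ring.
by apply: ltr_wpDl; [apply: mulr_ge0; [rewrite subr_ge0|exact: ltW]|exact: mulr_gt0].
Qed.

(* [s > 0] selects the left side of e, [s < 0] the right one. *)
Definition side_face e (s : R) f : Prop := forall q, inner e q ->
  \forall x \near q, 0 < s * eside e x -> face f x.

(** The face next to [e] is locally constant along the interior of [e], so the one found at the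
    midpoint serves everywhere. *)
Lemma side_face_exists e (s : R) : s != 0 -> exists f, side_face e s f.
Proof.
move=> s0; have mi := midE_inner e; have [f hf] := inner_half mi s0; exists f => q qi.
pose W x := \forall y \near x, 0 < s * eside e y -> face f y.
have iseg x : segment (midE tl hd p e) q x -> inner e x.
  move: mi qi => [t1 /andP[h1 h2] ->] [t2 /andP[h3 h4] ->] [t /andP[h5 h6] ->].
  exists ((1 - t) * t1 + t * t2).
    have [->|tn] := eqVneq t 0; first by rewrite subr0 mul1r mul0r addr0 h1.
    have {}h5 : 0 < t by rewrite lt_def tn.
    have k1 : 0 <= (1 - t) * t1 by rewrite mulr_ge0 ?subr_ge0 // ltW.
    have k2 : 0 <= (1 - t) * (1 - t1) by rewrite mulr_ge0 ?subr_ge0 // ltW.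
    have k3 : 0 < t * t2 by rewrite mulr_gt0.
    have k4 : 0 < t * (1 - t2) by rewrite mulr_gt0 // subr_gt0.
    by apply/andP; split; lra.
  by apply: cV2P; rewrite !mxE; ring.
apply: (@clopen_connected _ (segment (midE tl hd p e) q) W _ _ (midE tl hd p e)) => //.
- exact: connected_segment.
- move=> x /iseg xi; have [f' hf'] := inner_half xi s0.
  have dich y : inner e y -> (\forall z \near y, 0 < s * eside e z -> face f' z) -> W y <-> f = f'.
    move=> yi hy; split; last by move=> ff; rewrite /W ff.
    move=> Wy; have hh : \forall z \near y, 0 < s * eside e z -> face f z /\ face f' z.
      by near=> z => sz; split; move: sz; near: z.
    by have [z /[apply] -[fz fz']] := near_half yi s0 hh; apply: face_uniq fz fz'.
  have := near_join hf'; apply: filterS => y hy /iseg yi.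
  by rewrite (dich y) // (dich x).
- exact: segment_left.
- exact: segment_right.
Unshelve. all: by end_near.
Qed.

Lemma side_face_uniq e (s : R) f f' : s != 0 -> side_face e s f -> side_face e s f' -> f = f'.
Proof.
move=> s0 h h'; have mi := midE_inner e.
have hh : \forall z \near midE tl hd p e, 0 < s * eside e z -> face f z /\ face f' z.
  have h1 := h _ mi; have h2 := h' _ mi.
  by near=> z => sz; split; move: sz; near: z.
by have [z /[apply] -[fz fz']] := near_half mi s0 hh; apply: face_uniq fz fz'.
Unshelve. all: by end_near.
Qed.

(** Links [side_face] to the probe along the normal in [left_of] and [right_of]. For the converse,
    the face that exists on that side also contains the start of the normal, and two faces sharing a
    point coincide. *)
Lemma side_face_normal e (s : R) f : s != 0 -> side_face e s f <->
  exists2 eps : R, 0 < eps &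
    forall t, 0 < t < eps -> face f (midE tl hd p e + t *: (s *: leftnormal tl hd p e)).
Proof.
move=> s0; have mi := midE_inner e.
have pos f' : side_face e s f' -> exists2 eps : R, 0 < eps &
    forall t, 0 < t < eps -> face f' (midE tl hd p e + t *: (s *: leftnormal tl hd p e)).
  move=> /(_ _ mi)/(near_path (s *: leftnormal tl hd p e))[eps e0 h]; exists eps => // t /andP[t0 te].
  apply: h; first by rewrite ltW.
  exact: eside_shift_gt0.
split; first exact: pos.
move=> [eps e0 h]; have [f' hf'] := side_face_exists e s0; have [eps' e0' h'] := pos f' hf'.
suff <- : f' = f by [].
have m0 : 0 < Num.min eps eps' by rewrite lt_min e0.
apply: (@face_uniq _ _ (midE tl hd p e + (Num.min eps eps' / 2) *: (s *: leftnormal tl hd p e))).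
- by apply: h'; rewrite divr_gt0 //= ltr_pdivrMr // (le_lt_trans (y := eps')) ?ge_min ?lexx ?orbT // ltr_pMr // ltr1n.
- by apply: h; rewrite divr_gt0 //= ltr_pdivrMr // (le_lt_trans (y := eps)) ?ge_min ?lexx ?orbT // ltr_pMr // ltr1n.
Qed.

Lemma left_ofP e f : left_of tl hd p face e f <-> side_face e 1 f.
Proof.
rewrite side_face_normal ?oner_neq0 // /left_of.
by split => -[eps e0 h]; exists eps => // t /h; rewrite ?scale1r.
Qed.

Lemma right_ofP e f : right_of tl hd p face e f <-> side_face e (-1) f.
Proof.
rewrite side_face_normal ?oppr_eq0 ?oner_neq0 // /right_of.
by split => -[eps e0 h]; exists eps => // t /h; rewrite scaleN1r scalerN.
Qed.

(** * Ray sums of flows as potentials *)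

Definition ray_sum (A : zmodType) (a : E -> A) x : A :=
  \sum_e a e *~ crossing (p (tl e)) (p (hd e)) x.

Definition flow (A : zmodType) (a : E -> A) : Prop :=
  forall v, \sum_e a e *~ incVE tl hd v e = 0.

Lemma incVEE v e : incVE tl hd v e = (v == hd e)%:R - (v == tl e)%:R.
Proof.
have [_ Hne _ _] := Hemb; rewrite /incVE; have [->|nh] := eqVneq v (hd e).
  case: eqVneq => // e0; by have := Hne e; rewrite e0 eqxx.
by case: eqVneq => // _; rewrite sub0r.
Qed.

(** Summation by parts: grouped by vertices, each value [u v] is multiplied by the conservation law
    at [v]. *)
Lemma flow_coboundary (A : zmodType) (a : E -> A) (u : V -> int) :
  flow a -> \sum_e a e *~ (u (hd e) - u (tl e)) = 0.
Proof.
move=> fa; transitivity (\sum_v (\sum_e a e *~ incVE tl hd v e) *~ u v); last first.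
  by rewrite big1 // => v _; rewrite fa mul0rz.
transitivity (\sum_v \sum_e a e *~ (incVE tl hd v e * u v)); last first.
  by apply: eq_bigr => v _; rewrite mulrz_suml; apply: eq_bigr => e _; rewrite mulrzA.
rewrite exchange_big; apply: eq_bigr => e _ /=; rewrite -mulrz_sumr; congr (_ *~ _).
under eq_bigr do rewrite incVEE mulrBl.
rewrite sumrB; congr (_ - _).
  by rewrite (bigD1 (hd e)) //= eqxx mul1r big1 ?addr0 // => v /negbTE ->; rewrite mul0r.
by rewrite (bigD1 (tl e)) //= eqxx mul1r big1 ?addr0 // => v /negbTE ->; rewrite mul0r.
Qed.

(** The vertex terms of [crossing_off_segment] are the coboundary of one function of the vertices,
    the same for all edges, so the flow kills them and only the constants remain. *)
Lemma ray_sum_off (A : zmodType) (a : E -> A) x : flow a -> off x ->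
  \forall y \near x, ray_sum a y = ray_sum a x.
Proof.
move=> fa ox.
have /choice[c hc] e : exists c : int, \forall y \near x, crossing (p (tl e)) (p (hd e)) y =
    (above (p (hd e)) y && rightof x (p (hd e)))%:R -
    (above (p (tl e)) y && rightof x (p (tl e)))%:R + c.
  by apply: crossing_off_segment => ex; apply: ox; right; exists e.
have h : \forall y \near x, ray_sum a y = \sum_e a e *~ c e.
  apply: filterS (near_forall hc) => y hy; rewrite /ray_sum.
  under eq_bigr do rewrite hy mulrzDr.
  by rewrite big_split /= (flow_coboundary (fun v => (above (p v) y && rightof x (p v))%:R)) // add0r.
by have hx := nbhs_singleton h; apply: filterS h => y ->.
Qed.

Lemma ray_sum_inner (A : zmodType) (a : E -> A) e q : flow a -> inner e q ->
  exists c : A, \forall y \near q, eside e y != 0 ->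
    ray_sum a y = a e *~ (0 < eside e y)%R%:R + c.
Proof.
move=> fa qi.
have /choice[c hc] e' : exists c : int, \forall y \near q, eside e y != 0 ->
    crossing (p (tl e')) (p (hd e')) y =
    (above (p (hd e')) y && rightof q (p (hd e')))%:R -
    (above (p (tl e')) y && rightof q (p (tl e')))%:R +
    (if e' == e then (0 < eside e y)%R%:R else 0) + c.
  have [->|ne] := eqVneq e' e.
    by apply: crossing_on_segment; [exact: inner_segE|exact: (inner_vertex _ qi)..].
  have [c hc] := crossing_off_segment (inner_other qi ne).
  by exists c; apply: filterS hc => y -> _; rewrite addr0.
exists (\sum_e' a e' *~ c e'); apply: filterS (near_forall hc) => y hy sy; rewrite /ray_sum.
under eq_bigr do rewrite hy // mulrzDr mulrzDr.
rewrite !big_split /= (flow_coboundary (fun v => (above (p v) y && rightof q (p v))%:R)) // add0r.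
congr (_ + _).
by rewrite (bigD1 e) //= eqxx big1 ?addr0 // => e' /negbTE ->; rewrite mulr0z.
Qed.

Lemma ray_sum_face (A : zmodType) (a : E -> A) f x y : flow a -> face f x -> face f y ->
  ray_sum a x = ray_sum a y.
Proof.
move=> fa fx fy; apply: (@clopen_connected _ (face f) (fun z => ray_sum a x = ray_sum a z)
  (@face_connected f) _ x y) => // z fz.
by have := ray_sum_off fa (face_off fz); apply: filterS => w ->.
Qed.

Lemma ray_sum_jump (A : zmodType) (a : E -> A) e f f' x y : flow a ->
  side_face e 1 f -> side_face e (-1) f' -> face f x -> face f' y ->
  ray_sum a x - ray_sum a y = a e.
Proof.
move=> fa hf hf' fx fy; have mi := midE_inner e.
have [c hc] := ray_sum_inner fa mi.
have h1 : \forall z \near midE tl hd p e, 0 < 1 * eside e z -> face f z /\ ray_sum a z = a e + c.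
  have h2 := hf _ mi; near=> z => sz; split; first by move: sz; near: z.
  rewrite mul1r in sz; rewrite -[a e]mulr1z.
  have -> : (1 : int) = (0 < eside e z)%R%:R by rewrite sz.
  by move: (lt0r_neq0 sz); near: z.
have h1' : \forall z \near midE tl hd p e, 0 < -1 * eside e z -> face f' z /\ ray_sum a z = c.
  have h2 := hf' _ mi; near=> z => sz; split; first by move: sz; near: z.
  rewrite mulN1r oppr_gt0 in sz; rewrite -[c]add0r -[X in X + _](mulr0z (a e)).
  have -> : (0 : int) = (0 < eside e z)%R%:R by rewrite lt_gtF.
  by move: (ltr0_neq0 sz); near: z.
have [z /[apply] -[fz ez]] := near_half mi (oner_neq0 _) h1.
have [w /[apply] -[fw ew]] := near_half mi (ltr0_neq0 (ltrN10 _)) h1'.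
by rewrite (ray_sum_face fa fx fz) (ray_sum_face fa fy fw) ez ew addrK.
Unshelve. all: by end_near.
Qed.

Hypothesis Hreg : regular_faces tl hd p face.

(* A face on both sides of e would have e on its boundary cycle; but the ray sum
   of the cycle's unit flow is constant on the face and jumps by 1 across e. *)
Lemma side_face_neq e f : side_face e 1 f -> side_face e (-1) f -> False.
Proof.
move=> hl hr; have mi := midE_inner e; have [n [c [cinj cE bd]]] := Hreg f.
have : (closure (face f) `\` face f) (midE tl hd p e).
  split; last by move=> /face_off; apply; exact: inner_drawing mi.
  move=> B nB; have h := hl _ mi.
  have hh : \forall z \near midE tl hd p e, 0 < 1 * eside e z -> face f z /\ B z.
    near=> z => sz; split; last by near: z.
    by move: sz; near: z.
  by have [z /[apply] -[fz Bz]] := near_half mi (oner_neq0 _) hh; exists z.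
rewrite bd => -[i0 _ mi0].
have [ce hce] := choice cE.
have cei0 : ce i0 = e.
  apply/eqP; apply/negP => /negP ne; apply: (inner_other mi ne).
  by rewrite /segE; case: (hce i0) => -[-> ->] //; rewrite segmentC.
(* A cycle of at least three vertices does not run through an edge forth and back. Hence [e] is met
   only at [i0], and the flow on it cannot cancel to zero. *)
have ordS2 (i : 'I_n.+3) : ordS (ordS i) != i.
  rewrite -val_eqE /=; apply/eqP; have := ltn_ord i; move: (nat_of_ord i) => k hk.
  have [h|h] := ltnP k.+1 n.+3.
    rewrite (modn_small h); have [h'|h'] := ltnP k.+2 n.+3; first by rewrite modn_small //; lia.
    by rewrite (_ : k.+2 = n.+3) ?modnn; lia.
  by rewrite (_ : k.+1 = n.+3) ?modnn ?modn_small; lia.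
have ceinj i : ce i = ce i0 -> i = i0.
  move=> ee; have := hce i; rewrite ee; case: (hce i0) => -[-> ->] [] [/cinj h1 /cinj h2] //.
  - by have := ordS2 i0; rewrite h2 -h1 eqxx.
  - by have := ordS2 i0; rewrite h1 -h2 eqxx.
pose s i : int := if tl (ce i) == c i then 1 else -1.
pose a e' : int := \sum_i (if ce i == e' then s i else 0).
have fa : flow a.
  move=> v; under eq_bigr do rewrite mulrz_suml.
  rewrite exchange_big /=.
  transitivity (\sum_i ((v == c (ordS i))%:R - (v == c i)%:R : int)).
    apply: eq_bigr => i _; rewrite (bigD1 (ce i)) //= eqxx big1 ?addr0; last first.
      by move=> e' /negbTE ne; rewrite eq_sym ne mul0rz.
    rewrite incVEE /s; have [_ Hne _ _] := Hemb.
    have ne : tl (ce i) != hd (ce i) by apply: contra_neq (Hne (ce i)) => ->.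
    case: (hce i) => -[h1 h2].
      by rewrite h1 h2 eqxx intz.
    by rewrite -h2 (negbTE ne) -h1 mulNrz intz opprB.
  rewrite sumrB; apply/eqP; rewrite subr_eq0; apply/eqP.
  by rewrite [RHS](reindex_inj (@ordS_inj _)).
have : a e = 0.
  have [x fx _] := near_half mi (oner_neq0 _) (hl _ mi).
  have hh : \forall z \near midE tl hd p e, 0 < 1 * eside e z -> face f z by exact: hl.
  have [z /[apply] fz] := near_half mi (oner_neq0 _) hh.
  by rewrite -(ray_sum_jump fa hl hr fz fz) subrr.
rewrite /a (bigD1 i0) //= cei0 eqxx big1 ?addr0; first by rewrite /s; case: ifP.
by move=> i ne; case: eqP => // ee; move/eqP: ne; case; apply: ceinj; rewrite ee cei0.
Unshelve. all: by end_near.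
Qed.

Variables (Lf Rf : E -> F).
Hypothesis HL : forall e, side_face e 1 (Lf e).
Hypothesis HR : forall e, side_face e (-1) (Rf e).

(** * Functions constant on faces and their jumps along a segment *)

Section Jumps.
Variables (A : zmodType) (xi : F -> A).

(** Off the drawing the sum has exactly one term; on the drawing it is empty, so the value there is
    the junk value 0. *)
Definition value x : A := \sum_(f | `[< face f x >]) xi f.
Definition jump e : A := xi (Lf e) - xi (Rf e).

Lemma valueE f x : face f x -> value x = xi f.
Proof.
move=> fx; rewrite /value (big_pred1 f) // => f' /=.
apply/asboolP/eqP => [f'x|->//]; exact: face_uniq f'x fx.
Qed.

Lemma value_inner e q : inner e q ->
  \forall x \near q, off x -> value x = jump e *~ (0 < eside e x)%R%:R + xi (Rf e).
Proof.
move=> qi; have h1 := HL qi; have h2 := HR qi; have h3 := near_inner qi.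
near=> x => ox; have H1 : 0 < 1 * eside e x -> face (Lf e) x by near: x.
have H2 : 0 < -1 * eside e x -> face (Rf e) x by near: x.
have : eside e x != 0 by move: ox; near: x; apply: filterS h3 => z [].
rewrite mul1r mulN1r oppr_gt0 in H1 H2.
rewrite neq_lt => /orP[sx|sx].
  by rewrite (lt_gtF sx) mulr0z add0r; apply: valueE; exact: H2.
by rewrite sx mulr1z subrK; apply: valueE; exact: H1.
Unshelve. all: by end_near.
Qed.

Lemma near_off_exists z (P : 'cV[R]_2 -> Prop) : (forall v, z <> p v) ->
  (\forall x \near z, P x) -> exists2 x, P x & off x.
Proof.
move=> nv hP; have [dz|oz] := pselect (drawing tl hd p z); last first.
  by exists z => //; exact: nbhs_singleton hP.
case: (drawing_cases dz) => [[v /nv]|[e zi]] //.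
have h3 := near_inner zi.
have hh : \forall x \near z, P x /\ (eside e x != 0 -> off x).
  near=> x; split; first by near: x.
  by near: x; apply: filterS h3 => w [].
have [x [Px ox] sx] := near_half zi (oner_neq0 _) hh.
by exists x => //; apply: ox; rewrite mul1r in sx; rewrite gt_eqF.
Unshelve. all: by end_near.
Qed.

(** The segment meets the line of an edge of [S] only on the edge itself, so the side indicator of
    that edge changes only where the value jumps. Edges outside [S] have no jump where they are met.
    Thus the value minus the weighted indicators is constant along the segment. *)
Lemma segment_jump (S : pred E) x y : off x -> off y ->
  (forall v, ~ segment x y (p v)) ->
  (forall e z, S e -> segment x y z -> eside e z = 0 -> segE tl hd p e z) ->
  (forall e z, ~~ S e -> segment x y z -> inner e z -> jump e = 0) ->
  value y - value x =
    \sum_(e | S e) jump e *~ ((0 < eside e y)%R%:R - (0 < eside e x)%R%:R).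
Proof.
move=> ox oy nv hS hnS.
pose h z := value z - \sum_(e | S e) jump e *~ (0 < eside e z)%R%:R.
suff hxy : h x = h y.
  under eq_bigr do rewrite mulrzBr.
  rewrite sumrB; move: hxy; rewrite /h => /eqP; rewrite subr_eq => /eqP ->.
  by rewrite opprD opprB addrA addrCA subrr addr0.
have loc z : segment x y z -> exists c, \forall w \near z, off w -> h w = c.
  move=> xyz; have [dz|oz] := pselect (drawing tl hd p z); last first.
    exists (h z); have [f fz] := face_cover oz; have h1 := near_face fz.
    have h2 : \forall w \near z, forall e, S e -> (0 < eside e w) = (0 < eside e z).
      apply: (@near_forall _ _ (fun e w => S e -> (0 < eside e w) = (0 < eside e z))) => e.
      have [Se|nSe] := boolP (S e); last by apply: near_always.
      have /near_side : eside e z != 0.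
        by apply/eqP => /(hS e z Se xyz) ez; apply: oz; right; exists e.
      by apply: filterS => w [].
    near=> w => _; rewrite /h; congr (_ - _).
      have fw : face f w by near: w.
      by rewrite (valueE fz) (valueE fw).
    apply: eq_bigr => e Se; congr (_ *~ _%:R).
    have H : forall e, S e -> (0 < eside e w) = (0 < eside e z) by near: w.
    by rewrite H.
  case: (drawing_cases dz) => [[v zv]|[e0 zi]]; first by case: (nv v); rewrite -zv.
  exists (xi (Rf e0) - \sum_(e | S e && (e != e0)) jump e *~ (0 < eside e z)%R%:R).
  have h1 := value_inner zi.
  have h2 : \forall w \near z, forall e, S e && (e != e0) -> (0 < eside e w) = (0 < eside e z).
    apply: (@near_forall _ _ (fun e w => S e && (e != e0) -> (0 < eside e w) = (0 < eside e z))) => e.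
    have [/andP[Se ne]|nSe] := boolP (S e && (e != e0)); last by apply: near_always.
    have /near_side : eside e z != 0.
      by apply/eqP => /(hS e z Se xyz)/(inner_other zi ne).
    by apply: filterS => w [].
  near=> w => ow; have vw : value w = jump e0 *~ (0 < eside e0 w)%R%:R + xi (Rf e0).
    by move: ow; near: w.
  have H : forall e, S e && (e != e0) -> (0 < eside e w) = (0 < eside e z) by near: w.
  rewrite /h vw; have [Se0|nSe0] := boolP (S e0).
    rewrite (bigD1 e0) //= opprD addrA [X in X - _ = _]addrAC subrr add0r; congr (_ - _).
    by apply: eq_bigr => e /H ->.
  rewrite (hnS _ _ nSe0 xyz zi) mul0rz add0r; congr (_ - _).
  have eqS e : S e = S e && (e != e0).
    by have [->|] := eqVneq e e0; rewrite ?andbT // andbF (negbTE nSe0).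
  by rewrite (eq_bigl _ _ eqS); apply: eq_bigr => e /H ->.
(* Points off the drawing accumulate at every point that is not a vertex, so the local constant of
   [loc] is unique. *)
have dich c c' z : segment x y z -> (\forall w \near z, off w -> h w = c') ->
    (\forall w \near z, off w -> h w = c) <-> c = c'.
  move=> xyz h1; split; last by move=> ->.
  move=> h2; have nz v : z <> p v by move=> zv; case: (nv v); rewrite -zv.
  have [w [e1 e2] ow] : exists2 w, ((off w -> h w = c) /\ (off w -> h w = c')) & off w.
    by apply: near_off_exists nz _; near=> w; split; near: w.
  by rewrite -e1 // -e2.
pose W z := \forall w \near z, off w -> h w = h x.
have : W y.
  apply: (@clopen_connected _ (segment x y) W _ _ x) => //.
  - exact: connected_segment.
  - move=> z xyz; have [c hc] := loc z xyz.
    have := near_join hc; apply: filterS => w hw xyw.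
    by rewrite /W (dich _ c w) // (dich _ c z).
  - exact: segment_left.
  - exact: segment_right.
  - have [c hc] := loc x (segment_left x y).
    by rewrite /W (nbhs_singleton hc).
by move=> /nbhs_singleton /(_ oy).
Unshelve. all: by end_near.
Qed.

Lemma face_point f : exists x, face f x.
Proof.
have [H _ _] := Hfaces; have [x ox ->] := H f; exists x.
exact: connected_component_refl.
Qed.

Lemma jump0_const : (forall e, jump e = 0) -> forall f f', xi f = xi f'.
Proof.
move=> J0 f f'; have [x fx] := face_point f; have [y fy] := face_point f'.
have [exy|nxy] := eqVneq x y; first by rewrite (face_uniq fx (_ : face f' x)) // exy.
(* The end [y] is moved along [d], the quarter turn of [y - x]. If the segment from [x] to
   [y + t *: d] passes through [p v], then [t] is the quotient [bad v], so finitely many values of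
   [t] are to be avoided. *)
pose d : 'cV[R]_2 := \col_i (if i == 0 then - (y 1 0 - x 1 0) else y 0 0 - x 0 0).
pose bad v := cross (y - x) (p v - x) / dot (y - x) (p v - x).
have [eps e0 h] := near_path d (near_face fy).
have [eps' e0' h'] := finite_avoid [seq bad v | v <- enum V].
pose t := Num.min eps eps' / 2.
have m0 : 0 < Num.min eps eps' by rewrite lt_min e0.
have t0 : 0 < t by rewrite divr_gt0.
have [te te'] : t < eps /\ t < eps'.
  have : t < Num.min eps eps' by rewrite /t ltr_pdivrMr // ltr_pMr // ltr1n.
  by rewrite lt_min => /andP.
have fy' : face f' (y + t *: d) by apply: h; rewrite ltW.
have tb : t \notin [seq bad v | v <- enum V] by apply: h'; rewrite t0.
rewrite -(valueE fx) -(valueE fy'); apply/eqP; rewrite -subr_eq0; apply/eqP.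
rewrite -opprB (@segment_jump pred0) ?big_pred0 ?oppr0 //; first exact: face_off fx.
- exact: face_off fy'.
- move=> v [s s01 ev]; move/negP: tb; apply; apply/mapP; exists v; rewrite ?mem_enum //.
  have dp : 0 < dot (y - x) (y - x) by apply: dot_gt0; rewrite subr_eq0 eq_sym.
  have e1 : dot (y - x) (p v - x) = s * dot (y - x) (y - x).
    by rewrite ev /dot !mxE /=; ring.
  have e2 : cross (y - x) (p v - x) = t * (s * dot (y - x) (y - x)).
    by rewrite ev /cross /dot !mxE /=; ring.
  rewrite /bad e1 e2 mulfK // mulf_neq0 ?(gt_eqF dp) //.
  apply: contra_not_neq (face_off fx) => s0; left; exists v.
  by rewrite ev s0 subr0 scale1r scale0r addr0.
Qed.

End Jumps.

(** * Going around a vertex *)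

Section VertexStar.
Variables (A : zmodType) (xi : F -> A) (v : V).

Definition at_vertex e : bool := (v == tl e) || (v == hd e).
Definition dir e : 'cV[R]_2 := p (if v == tl e then hd e else tl e) - p v.

Lemma tl_neq_hd e : tl e != hd e.
Proof. by have [_ Hne _ _] := Hemb; apply: contra_neq (Hne e) => ->. Qed.

Lemma at_vertex_cases e : at_vertex e ->
  [/\ tl e = v, incVE tl hd v e = -1 & dir e = p (hd e) - p (tl e)] \/
  [/\ hd e = v, incVE tl hd v e = 1 & dir e = p (tl e) - p (hd e)].
Proof.
have ne := tl_neq_hd e; rewrite /at_vertex incVEE /dir => /orP[/eqP ->|/eqP ->].
  by left; rewrite eqxx (negbTE ne).
by right; rewrite eqxx eq_sym (negbTE ne).
Qed.

Lemma dir_neq0 e : at_vertex e -> dir e != 0.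
Proof.
have [_ Hne _ _] := Hemb.
by move=> /at_vertex_cases[] [_ _ ->]; rewrite subr_eq0 // eq_sym.
Qed.

Lemma at_vertex_segE e z : at_vertex e ->
  segE tl hd p e z <-> segment (p v) (p v + dir e) z.
Proof.
move=> /at_vertex_cases[] [<- _ ->]; rewrite addrC subrK /segE //.
by rewrite segmentC.
Qed.

Lemma at_vertex_eside e z : at_vertex e ->
  eside e z = (- incVE tl hd v e)%:~R * cross (dir e) (z - p v).
Proof.
move=> /at_vertex_cases; case=> -[tv -> ->]; rewrite -tv; first by rewrite opprK mul1r.
by rewrite /eside mulN1r -sideC.
Qed.

Lemma incVE_notin e : ~~ at_vertex e -> incVE tl hd v e = 0.
Proof. by rewrite /at_vertex negb_or incVEE => /andP[/negbTE -> /negbTE ->]. Qed.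

(** Close to [p v], the segment from direction [q] to direction [r] meets just the edges at [v] that
    point into the open cone. Counterclockwise, an edge with tail [v] is passed from right to left;
    its [incVE] is -1, whence the minus sign. *)
Lemma cone_jump (q r : 'cV[R]_2) : 0 < cross q r ->
  (forall e, at_vertex e -> cross q (dir e) != 0) ->
  (forall e, at_vertex e -> cross r (dir e) != 0) ->
  exists2 eps : R, 0 < eps & forall t, 0 < t < eps ->
    value xi (p v + t *: r) - value xi (p v + t *: q) =
    - \sum_e (if at_vertex e && (0 < cross q (dir e)) && (cross r (dir e) < 0)
              then jump xi e *~ incVE tl hd v e else 0).
Proof.
move=> qr gq gr; have [Hinj _ Hv _] := Hemb.
(* The three conditions fix a ball around [p v] that edges not at [v] do not reach, that contains no
   other vertex, and in which no edge at [v] ends. *)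
have n1 : \forall z \near p v, forall e, ~~ at_vertex e -> ~ segE tl hd p e z.
  apply: (@near_forall _ _ (fun e z => ~~ at_vertex e -> ~ segE tl hd p e z)) => e.
  have [ae|nae] := boolP (at_vertex e); first by apply: near_always.
  have : ~ segE tl hd p e (p v).
    by move=> /Hv vE; move/negP: nae; apply; apply/orP; case: vE => ->; rewrite eqxx; [left|right].
  by move=> /near_off_segment; apply: filterS => z.
have n2 : \forall z \near p v, forall u, u != v -> z <> p u.
  apply: (@near_forall _ _ (fun u z => u != v -> z <> p u)) => u.
  have [->|ne] := eqVneq u v; first by apply: near_always.
  have : p v != p u by apply: contra_neq ne => /Hinj.
  by move=> /near_off_vertex; apply: filterS => z /eqP.
have n3 : \forall z \near p v, forall e, at_vertex e -> dot (dir e) (z - p v) < dot (dir e) (dir e).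
  apply: (@near_forall _ _ (fun e z => at_vertex e -> dot (dir e) (z - p v) < dot (dir e) (dir e))) => e.
  have [ae|nae] := boolP (at_vertex e); last by apply: near_always.
  have : dot (dir e) (p v - p v) < dot (dir e) (dir e).
    by rewrite subrr {1}/dot !mxE !mulr0 addr0 dot_gt0 // dir_neq0.
  by move=> /(near_lt (@dot_continuous R (dir e) (p v))); apply: filterS => z.
have [eps0 e00 hball] : exists2 eps : R, 0 < eps & forall z, ball (p v) eps z ->
    [/\ forall e, ~~ at_vertex e -> ~ segE tl hd p e z, forall u, u != v -> z <> p u &
      forall e, at_vertex e -> dot (dir e) (z - p v) < dot (dir e) (dir e)].
  by apply: near_ball; near=> z; split; near: z.
have nb : \forall z \near p v, ball (p v) eps0 z by apply/nbhs_ballP; exists eps0.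
have [e1 e10 h1] := near_path q nb; have [e2 e20 h2] := near_path r nb.
exists (Num.min e1 e2); first by rewrite lt_min e10.
move=> t; rewrite lt_min => /and3P[t0 te1 te2].
have bx := h1 t; have by_ := h2 t; rewrite ltW // te1 in bx; rewrite ltW // te2 in by_.
have {}bx := bx isT; have {}by_ := by_ isT.
have coordz z : segment (p v + t *: q) (p v + t *: r) z -> exists al be : R,
    [/\ 0 <= al, 0 <= be, 0 < al + be & z - p v = al *: q + be *: r].
  move=> [s /andP[s0 s1] ->]; exists (t * (1 - s)), (t * s); split.
  - by rewrite mulr_ge0 ?subr_ge0 // ltW.
  - by rewrite mulr_ge0 // ltW.
  - by rewrite -mulrDr subrK mulr1.
  - by apply: cV2P; rewrite !mxE; ring.
have bz z : segment (p v + t *: q) (p v + t *: r) z -> ball (p v) eps0 z.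
  exact: ball_segment.
have crossqz al be z : z - p v = al *: q + be *: r ->
    cross q (z - p v) = be * cross q r /\ cross r (z - p v) = - al * cross q r.
  by move=> ->; rewrite /cross !mxE; split; ring.
have nv z : segment (p v + t *: q) (p v + t *: r) z -> z <> p v.
  move=> /coordz[al [be [a0 b0 ab ez]]] zv; have [c1 c2] := crossqz _ _ _ ez.
  move: c1 c2; rewrite zv subrr /cross !mxE !mulr0 subrr => /esym/eqP + /esym/eqP.
  by rewrite !mulf_eq0 oppr_eq0 !(gt_eqF qr) !orbF => /eqP be0 /eqP al0; move: ab; rewrite be0 al0 addr0 ltxx.
have nonvertex z u : segment (p v + t *: q) (p v + t *: r) z -> z <> p u.
  move=> sz; have [->|ne] := eqVneq u v; first exact: nv.
  by have [_ H _] := hball _ (bz _ sz); exact: H.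
have onedge e z : segment (p v + t *: q) (p v + t *: r) z -> segE tl hd p e z ->
    at_vertex e /\ exists2 la : R, 0 < la & z - p v = la *: dir e.
  move=> sz ez; have ae : at_vertex e.
    by apply: contraPT ez => nae; have [H _ _] := hball _ (bz _ sz); exact: H.
  split=> //; move: ez => /(at_vertex_segE _ ae)[la /andP[l0 l1] ez]; exists la.
    rewrite lt_neqAle l0 andbT; apply: contra_not_neq (nv _ sz) => l00.
    by rewrite ez -l00 subr0 scale1r scale0r addr0.
  by rewrite ez; apply: cV2P; rewrite !mxE; ring.
have crossZ (a : 'cV[R]_2) (la : R) b : cross a (la *: b) = la * cross a b.
  by rewrite /cross !mxE; ring.
have crossC (a b : 'cV[R]_2) : cross a b = - cross b a by rewrite /cross; ring.
have crossxx (a : 'cV[R]_2) : cross a a = 0 by rewrite /cross; ring.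
have offx (w : 'cV[R]_2) : segment (p v + t *: q) (p v + t *: r) (p v + t *: w) ->
    (forall e, at_vertex e -> cross w (dir e) != 0) -> off (p v + t *: w).
  move=> sw gw [[u wu]|[e _ we]]; first exact: nonvertex sw wu.
  have [ae [la l0 hla]] := onedge _ _ sw we.
  move: (gw _ ae); have : cross (t *: w) (dir e) = 0.
    rewrite crossC (_ : t *: w = la *: dir e) ?crossZ ?crossxx ?mulr0 ?oppr0 //.
    by rewrite -hla addrC addKr.
  by rewrite crossC crossZ -mulrN -crossC => /eqP; rewrite mulf_eq0 (gt_eqF t0) /= => ->.
pose S e := at_vertex e && (0 < cross q (dir e)) && (cross r (dir e) < 0).
rewrite (@segment_jump _ xi S).
- rewrite -sumrN [LHS]big_mkcond; apply: eq_bigr => e _; rewrite -/(S e).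
  have [/andP[/andP[ae c1] c2]|_] := boolP (S e); last by rewrite oppr0.
  rewrite !at_vertex_eside //.
  have ey : cross (dir e) (p v + t *: r - p v) = t * (- cross r (dir e)).
    by rewrite addrC addKr crossZ crossC.
  have ex : cross (dir e) (p v + t *: q - p v) = t * (- cross q (dir e)).
    by rewrite addrC addKr crossZ crossC.
  have y0 : 0 < cross (dir e) (p v + t *: r - p v) by rewrite ey mulr_gt0 // oppr_gt0.
  have x0 : cross (dir e) (p v + t *: q - p v) < 0 by rewrite ex pmulr_rlt0 // oppr_lt0.
  case: (at_vertex_cases ae) => -[_ -> _].
    by rewrite opprK !mul1r y0 (lt_gtF x0) subr0 mulrN1z opprK.
  by rewrite !mulN1r !oppr_gt0 x0 (lt_gtF y0) sub0r mulrN1z.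
- by apply: offx gq; exact: segment_left.
- by apply: offx gr; exact: segment_right.
- by move=> u su; exact: nonvertex su _.
- move=> e z /andP[/andP[ae c1] c2] sz; rewrite at_vertex_eside // => /eqP.
  rewrite mulf_eq0 intr_eq0 oppr_eq0.
  have -> /= : (incVE tl hd v e == 0) = false by case: (at_vertex_cases ae) => -[_ -> _].
  move=> /eqP dz; apply/(at_vertex_segE _ ae); apply: segment_dot.
  + by rewrite -subr_eq0 opprD addNKr oppr_eq0 dir_neq0.
  + by rewrite /side addrC addKr.
  + rewrite [p v + dir e]addrC addrK; have [_ _ H] := hball _ (bz _ sz).
    rewrite [X in _ && X]ltW ?H // andbT.
    have [al [be [a0 b0 ab ez]]] := coordz _ sz.
    have [k1 k2] := crossqz _ _ _ ez.
    have dd : cross q r *: dir e = - cross r (dir e) *: q + cross q (dir e) *: r.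
      by apply: cV2P; rewrite /cross !mxE; ring.
    (* Places [z] on the ray of [dir e] and not on the opposite one: for [z] on the line of [e] the
       last term vanishes, and the projection times two positive factors becomes a product of
       nonnegative ones. *)
    have l1 : dot (dir e) (z - p v) * cross q r * (- cross r (dir e)) =
       al * cross q r * (cross q r * dot (dir e) (dir e)) +
       cross q r * cross (dir e) (z - p v) * dot (dir e) r.
      rewrite ez; move: (dir e) => d; rewrite /cross /dot !mxE; ring.
    have D0 := dot_gt0 (dir_neq0 ae).
    rewrite dz mulr0 mul0r addr0 in l1.
    rewrite -(pmulr_lge0 _ qr) -(pmulr_lge0 _ (_ : 0 < - cross r (dir e))) ?oppr_gt0 // l1.
    by rewrite !mulr_ge0 // ltW.
(* An edge that is hit points along a nonnegative combination of [q] and [r]. As it is parallel to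
   neither, both inequalities defining [S] are strict. *)
- move=> e z nSe sz ez; have [ae [la l0 hla]] := onedge _ _ sz (inner_segE ez).
  exfalso; move/negP: nSe; apply; rewrite /S ae /=.
  have [al [be [a0 b0 ab ezz]]] := coordz _ sz.
  have [k1 k2] := crossqz _ _ _ ezz; move: k1 k2; rewrite hla !crossZ => k1 k2.
  rewrite !lt_neqAle (gr _ ae) eq_sym (gq _ ae) /=; apply/andP; split.
    by rewrite -(pmulr_rge0 _ l0) k1 mulr_ge0 // ltW.
  by rewrite -(pmulr_rle0 _ l0) k2 mulNr oppr_le0 mulr_ge0 // ltW.
Unshelve. all: by end_near.
Qed.

(* The four cones spanned by q, r, -q, -r tile the plane around v, so the value
   returns to itself after crossing every edge at v once, counterclockwise. *)
Lemma vertex_jump : \sum_e jump xi e *~ incVE tl hd v e = 0.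
Proof.
(* The directions [q] and [r] will have slopes [s] and [-s]; both must avoid the slopes of the edges
   at [v], so that no edge runs along the border of a cone. *)
have [s0 s00 hs0] := finite_avoid
  ([seq dir e 1 0 / dir e 0 0 | e <- enum E] ++ [seq - (dir e 1 0 / dir e 0 0) | e <- enum E]).
pose s := s0 / 2; have s_gt0 : 0 < s by rewrite divr_gt0.
have := hs0 s; rewrite s_gt0 /= ltr_pdivrMr // ltr_pMr // ltr1n => /(_ isT).
rewrite mem_cat negb_or => /andP[m1 m2].
pose q : 'cV[R]_2 := \col_i (if i == 0 then 1 else s).
pose r : 'cV[R]_2 := \col_i (if i == 0 then -1 else s).
have crossq d : cross q d = d 1 0 - s * d 0 0 by rewrite /cross !mxE /= mul1r.
have crossr d : cross r d = - d 1 0 - s * d 0 0 by rewrite /cross !mxE /= mulN1r.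
have gq e : at_vertex e -> cross q (dir e) != 0.
  move=> ae; have := dir_neq0 ae; apply: contra_neq; rewrite crossq => /eqP.
  rewrite subr_eq0 => /eqP h.
  have [d0|d0] := eqVneq (dir e 0 0) 0.
    by apply: cV2P; rewrite [RHS]mxE // h d0 mulr0.
  move/mapP: m1; case; exists e; rewrite ?mem_enum // h mulfK //.
have gr e : at_vertex e -> cross r (dir e) != 0.
  move=> ae; have := dir_neq0 ae; apply: contra_neq; rewrite crossr => /eqP.
  rewrite subr_eq0 => /eqP h.
  have [d0|d0] := eqVneq (dir e 0 0) 0.
    by apply: cV2P; rewrite [RHS]mxE // -[LHS]opprK h d0 mulr0 oppr0.
  move/mapP: m2; case; exists e; rewrite ?mem_enum // -mulNr h mulfK //.
have qr : 0 < cross q r by rewrite /cross !mxE /=; lra.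
have crossNl (a b : 'cV[R]_2) : cross (- a) b = - cross a b by rewrite /cross !mxE; ring.
have crossNr (a b : 'cV[R]_2) : cross a (- b) = - cross a b by rewrite /cross !mxE; ring.
have crossC (a b : 'cV[R]_2) : cross a b = - cross b a by rewrite /cross; ring.
have gNq e : at_vertex e -> cross (- q) (dir e) != 0 by rewrite crossNl oppr_eq0; exact: gq.
have gNr e : at_vertex e -> cross (- r) (dir e) != 0 by rewrite crossNl oppr_eq0; exact: gr.
have [e1 p1 h1] := cone_jump qr gq gr.
have [|e2 p2 h2] := @cone_jump r (- q) _ gr gNq; first by rewrite crossNr -crossC.
have [|e3 p3 h3] := @cone_jump (- q) (- r) _ gNq gNr; first by rewrite crossNl crossNr opprK.
have [|e4 p4 h4] := @cone_jump (- r) q _ gNr gq; first by rewrite crossNl -crossC.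
pose t := Num.min (Num.min e1 e2) (Num.min e3 e4) / 2.
have m0 : 0 < Num.min (Num.min e1 e2) (Num.min e3 e4) by rewrite !lt_min p1 p2 p3.
have t0 : 0 < t by rewrite divr_gt0.
have : t < Num.min (Num.min e1 e2) (Num.min e3 e4).
  by rewrite /t ltr_pdivrMr // ltr_pMr // ltr1n.
rewrite !lt_min => /andP[/andP[t1 t2] /andP[t3 t4]].
have {}h1 := h1 t; rewrite t0 t1 in h1; have {}h1 := h1 isT.
have {}h2 := h2 t; rewrite t0 t2 in h2; have {}h2 := h2 isT.
have {}h3 := h3 t; rewrite t0 t3 in h3; have {}h3 := h3 isT.
have {}h4 := h4 t; rewrite t0 t4 in h4; have {}h4 := h4 isT.
have tele (a b c d : A) : (b - a) + (c - b) + (d - c) + (a - d) = 0.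
  by rewrite (addrC (b - a)) subrKA (addrC (c - a)) subrKA subrKA subrr.
have := tele (value xi (p v + t *: q)) (value xi (p v + t *: r))
  (value xi (p v + t *: - q)) (value xi (p v + t *: - r)).
rewrite h1 h2 h3 h4 -!opprD -!big_split /= => /eqP; rewrite oppr_eq0 => /eqP.
move=> {2}<-; apply: eq_bigr => e _; rewrite !crossNl !oppr_gt0 !oppr_lt0.
have [ae|nae] := boolP (at_vertex e); last by rewrite incVE_notin // mulr0z !addr0.
move: (gq e ae) (gr e ae); rewrite /=.
by case: (ltgtP (cross q (dir e)) 0) => // _ _; case: (ltgtP (cross r (dir e)) 0) => // _ _ /=;
  rewrite ?addr0 ?add0r.
Qed.

End VertexStar.

(** Here the distinctness of the two sides enters: a face on both sides would get 1 from [incEF],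
    whereas the difference of indicators gives 0. *)
Lemma incEFE e f : incEF tl hd p face e f = (f == Lf e)%:R - (f == Rf e)%:R.
Proof.
have N10 : (-1 : R) != 0 by rewrite oppr_eq0 oner_neq0.
have lE : `[< left_of tl hd p face e f >] = (f == Lf e).
  apply/asboolP/eqP => [/left_ofP h|->]; last exact/left_ofP/HL.
  exact: side_face_uniq (oner_neq0 _) h (@HL e).
have rE : `[< right_of tl hd p face e f >] = (f == Rf e).
  apply/asboolP/eqP => [/right_ofP h|->]; last exact/right_ofP/HR.
  exact: side_face_uniq N10 h (@HR e).
rewrite /incEF lE rE; have [->|_] := eqVneq f (Lf e); last by case: eqP.
case: eqP => // LR; exfalso; apply: (@side_face_neq e (Lf e)); first exact: HL.
by rewrite LR.
Qed.

Lemma sum_incEF (k : pzRingType) (W : lmodType k) (xi : F -> W) e :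
  \sum_f (incEF tl hd p face e f)%:~R *: xi f = jump xi e.
Proof.
under eq_bigr do rewrite incEFE rmorphB scalerBl /=.
rewrite sumrB /jump; congr (_ - _).
  by rewrite (bigD1 (Lf e)) //= eqxx scale1r big1 ?addr0 // => f /negbTE ->; rewrite scale0r.
by rewrite (bigD1 (Rf e)) //= eqxx scale1r big1 ?addr0 // => f /negbTE ->; rewrite scale0r.
Qed.

Lemma flow_jump (A : zmodType) (a : E -> A) : flow a -> exists xi : F -> A, jump xi =1 a.
Proof.
move=> fa; have [pt hpt] := choice face_point; exists (fun f => ray_sum a (pt f)) => e.
exact: (ray_sum_jump fa (@HL e) (@HR e)).
Qed.

(** The factor [c] compares the normal of the image edge with the image of the normal; a negative
    [c] exchanges left and right. *)
Lemma side_face_map (M : 'M[R]_2) (e e' : E) f f' (s c : R) : s != 0 -> c != 0 ->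
  midE tl hd p e' = M *m midE tl hd p e ->
  leftnormal tl hd p e' = c *: (M *m leftnormal tl hd p e) ->
  face f' = (fun x => M *m x) @` face f ->
  side_face e (s * c) f -> side_face e' s f'.
Proof.
move=> s0 c0 em en ef; rewrite !side_face_normal // ?mulf_neq0 // => -[eps e0 h].
exists eps => // t /h ht; rewrite ef; exists (midE tl hd p e + t *: ((s * c) *: leftnormal tl hd p e)) => //.
by rewrite mulmxDr em en !scalerA; congr (_ + _); rewrite -scalemxAr mulrA.
Qed.

End Faces.

(** * Isotypic components *)

Section Isotypic.
Variables (k : fieldType) (gT : finGroupType) (G : {group gT}) (n : nat).
Variable rG : mx_representation k G n.

(** [isotypic] quantifies over bundled linear maps, so maps built pointwise have to be packed. *)
Lemma linear_of (U W : lmodType k) (f : U -> W) : linear f -> exists g : {linear U -> W}, g =1 f.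
Proof.
move=> lf; pose fL := GRing.isLinear.Build k U W *:%R f lf.
by exists (HB.pack f fL : {linear U -> W}).
Qed.

Section Sums.
Variables (W : lmodType k) (act : gT -> W -> W) (M : W -> Prop).

Lemma isotypicS (M' : W -> Prop) x : (forall y, M y -> M' y) ->
  isotypic rG act M x -> isotypic rG act M' x.
Proof.
move=> MM' [N [fs [ys [h ->]]]]; exists N, fs, ys; split=> // i.
by have [h1 h2 h3] := h i; split => // y; apply: MM'.
Qed.

Lemma isotypic0 : isotypic rG act M 0.
Proof. by exists 0%N, (fun=> \0), (fun=> 0); split; [case|rewrite big_ord0]. Qed.

Lemma isotypicD x y : isotypic rG act M x -> isotypic rG act M y ->
  isotypic rG act M (x + y).
Proof.
move=> [N [fs [ys [h ->]]]] [N' [fs' [ys' [h' ->]]]].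
exists (N + N')%N, (fun i : 'I_(N + N') => match fintype.split i with inl j => fs j | inr j => fs' j end),
  (fun i : 'I_(N + N') => match fintype.split i with inl j => ys j | inr j => ys' j end); split.
  by move=> i; case: (fintype.split i).
rewrite big_split_ord; congr (_ + _); apply: eq_bigr => i _.
  by rewrite -[lshift _ _]/(unsplit (inl i)) unsplitK.
by rewrite -[rshift _ _]/(unsplit (inr i)) unsplitK.
Qed.

Lemma isotypic_sum N (x : 'I_N -> W) : (forall i, isotypic rG act M (x i)) ->
  isotypic rG act M (\sum_i x i).
Proof.
move=> h; elim/big_ind: _ => // [|y z]; [exact: isotypic0|exact: isotypicD].
Qed.

End Sums.

Hypothesis Hirr : mx_irreducible rG.

(* The orbit of a nonzero kernel vector spans: its left annihilator is a proper
   submodule of the row representation. *)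
Lemma irr_linear_inj (W : lmodType k) (act : gT -> W -> W) (f : {linear 'cV[k]_n -> W}) :
  (forall g, act g 0 = 0) ->
  (forall g, g \in G -> forall y, f (rG g *m y) = act g (f y)) ->
  injective f \/ (forall y, f y = 0).
Proof.
move=> act0 eqf; have [inj|ninj] := pselect (injective f); [by left|right].
have [y0 y00 fy0] : exists2 y0, y0 != 0 & f y0 = 0.
  apply: contrapT => h; apply: ninj => y1 y2 e12; apply/eqP; rewrite -subr_eq0.
  apply/negP => /negP ne; apply: h; exists (y1 - y2) => //.
  by rewrite linearB e12 subrr.
(* [mx_irreducible] speaks of row vectors while [f] takes columns, hence the detour through
   [kermx Y]. The columns are the orbit of [y0], indexed by all of [gT] and zero outside [G]. *)
pose Y : 'M[k]_(n, #|gT|) := \matrix_(i, j)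
  (if enum_val j \in G then (rG (enum_val j) *m y0) i 0 else 0).
have colY (u : 'rV[k]_n) : u *m Y = 0 <-> forall g, g \in G -> u *m rG g *m y0 = 0.
  split=> [h g gG|h].
    apply/matrixP => i j; rewrite !ord1 -mulmxA; have /matrixP/(_ 0 (enum_rank g)) := h.
    rewrite !mxE => e0; rewrite -[RHS]e0; apply: eq_bigr => l _.
    by rewrite [Y _ _]mxE enum_rankK gG.
  apply/matrixP => i j; rewrite !ord1 !mxE; have [gG|ngG] := boolP (enum_val j \in G).
    have /matrixP/(_ 0 0) := h _ gG; rewrite -mulmxA !mxE => e0.
    by rewrite -[RHS]e0; apply: eq_bigr => l _; rewrite [Y _ _]mxE gG.
  by rewrite big1 // => l _; rewrite mxE (negbTE ngG) mulr0.
have [_ irr] := iffLR (mx_irrP rG) Hirr.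
have modK : mxmodule rG (kermx Y).
  apply/mxmoduleP => g gG; apply/sub_kermxP; apply/row_matrixP => i.
  rewrite row_mul row0 row_mul; apply: (iffRL (colY _)) => h hG.
  have /(iffLR (colY _)) H : row i (kermx Y) *m Y = 0 by rewrite -row_mul mulmx_ker row0.
  by rewrite -(mulmxA _ (rG g)) -repr_mxM // H // groupM.
have K0 : kermx Y = 0.
  apply/eqP; apply/negP => /negP /(irr _ modK) full.
  have : 1%:M *m Y = 0 by apply/sub_kermxP; rewrite sub1mx.
  rewrite mul1mx => Y0; move/eqP: y00; apply.
  apply/matrixP => i j; rewrite ord1 mxE.
  have H := iffLR (colY (delta_mx 0 i)); rewrite Y0 mulmx0 in H.
  have /matrixP/(_ 0 0) := H erefl 1%g (group1 G).
  by rewrite repr_mx1 mulmx1 -rowE !mxE.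
have free : row_free Y by rewrite -kermx_eq0 K0.
move=> z; have -> : z = Y *m (pinvmx Y *m z) by rewrite mulmxA mulmxVp // mul1mx.
set c := pinvmx Y *m z.
have -> : Y *m c = \sum_j c j 0 *: (if enum_val j \in G then rG (enum_val j) *m y0 else 0).
  apply/matrixP => i j; rewrite ord1 summxE !mxE; apply: eq_bigr => l _.
  by rewrite !mxE mulrC; case: ifP => _ //; rewrite mxE.
rewrite linear_sum big1 // => j _; rewrite linearZ /=.
by case: ifP => gG; rewrite ?linear0 ?scaler0 // eqf // fy0 act0 scaler0.
Qed.

Variables (W W' : lmodType k) (act : gT -> W -> W) (act' : gT -> W' -> W').
Variables (M : W -> Prop) (M' : W' -> Prop) (L : {linear W -> W'}).
Hypothesis LM : forall x, M x -> M' (L x).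
Hypothesis Leq : forall g, g \in G -> forall x, M x -> L (act g x) = act' g (L x).

(** Each composite [L \o fs i] is injective or zero, and zero summands are dropped. Equivariance of
    [L] is asked on [M] only, since for [theta] it is established on reciprocal diagrams, where
    [phi_inv] really inverts [phiE]. *)
Lemma isotypic_map x : (forall g, act' g 0 = 0) ->
  isotypic rG act M x -> isotypic rG act' M' (L x).
Proof.
move=> act0 [N [fs [ys [h ->]]]]; rewrite linear_sum; apply: isotypic_sum => i /=.
have [fi fM feq] := h i; have [f hf] := @linear_of _ _ (L \o fs i) (linearP _).
have feq' g : g \in G -> forall y, f (rG g *m y) = act' g (f y).
  by move=> gG y; rewrite !hf /= feq // Leq.
have [finj|f0] := irr_linear_inj act0 feq'; last first.
  by rewrite -[L _]/((L \o fs i) (ys i)) -hf f0; exact: isotypic0.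
exists 1%N, (fun=> f), (fun=> ys i); split; last by rewrite big_ord1 hf.
by move=> _; split => // y; rewrite hf; exact: LM.
Qed.

Hypothesis char0 : (#|G|%:R : k) != 0.
Hypothesis M_lin : forall (a : k) x y, M x -> M y -> M (a *: x + y).
Hypothesis M0 : M 0.
Hypothesis M_act : forall g, g \in G -> forall x, M x -> M (act g x).
Hypothesis act_lin : forall g, linear (act g).
Hypothesis act_morph : {in G &, forall g h x, act (g * h)%g x = act g (act h x)}.
Hypothesis act'K : forall g, g \in G -> forall x, act' g^-1%g (act' g x) = x.
Hypothesis L_onto : forall x', M' x' -> exists2 x, M x & L x = x'.

(* Lift each summand linearly and average the lift over G, as in Maschke's theorem. *)
Lemma isotypic_lift x' : isotypic rG act' M' x' -> exists2 x, isotypic rG act M x & L x = x'.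
Proof.
have M_sum (I : finType) (P : pred I) (x : I -> W) : (forall i, P i -> M (x i)) -> M (\sum_(i | P i) x i).
  move=> h; elim/big_ind: _ => // y z My Mz; rewrite -[y]scale1r; exact: M_lin.
have M_scale a x : M x -> M (a *: x) by move=> Mx; rewrite -[_ *: _]addr0; exact: M_lin.
have act_sum g (I : finType) (P : pred I) (x : I -> W) : act g (\sum_(i | P i) x i) = \sum_(i | P i) act g (x i).
  by have [A hA] := linear_of (act_lin g); rewrite -hA linear_sum; apply: eq_bigr => i _; rewrite hA.
have act_scale g a x : act g (a *: x) = a *: act g x.
  by have [A hA] := linear_of (act_lin g); rewrite -!hA linearZ.
suff lift (f : {linear 'cV[k]_n -> W'}) : injective f -> (forall y, M' (f y)) ->
    (forall g, g \in G -> forall y, f (rG g *m y) = act' g (f y)) ->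
    exists f' : {linear 'cV[k]_n -> W}, [/\ injective f', forall y, M (f' y),
      forall g, g \in G -> forall y, f' (rG g *m y) = act g (f' y) & forall y, L (f' y) = f y].
  move=> [N [fs [ys [h ->]]]].
  have /choice[fs' hfs'] i : exists f' : {linear 'cV[k]_n -> W}, [/\ injective f', forall y, M (f' y),
      forall g, g \in G -> forall y, f' (rG g *m y) = act g (f' y) & forall y, L (f' y) = fs i y].
    by have [h1 h2 h3] := h i; exact: lift.
  exists (\sum_i fs' i (ys i)).
    by exists N, fs', ys; split => // i; have [h1 h2 h3 _] := hfs' i.
  by rewrite linear_sum; apply: eq_bigr => i _; have [_ _ _ ->] := hfs' i.
move=> finj fM feq.
have /choice[b hb] (j : 'I_n) : exists x, M x /\ L x = f (delta_mx j 0).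
  by have [x Mx Lx] := L_onto (fM (delta_mx j 0)); exists x.
pose f0 (y : 'cV[k]_n) := \sum_j y j 0 *: b j.
have f0M y : M (f0 y) by apply: M_sum => j _; apply: M_scale; have [] := hb j.
have Lf0 y : L (f0 y) = f y.
  rewrite linear_sum [in RHS](matrix_sum_delta y) linear_sum; apply: eq_bigr => j _.
  by rewrite big_ord1 !linearZ /=; have [_ ->] := hb j.
(* [f0] lifts [f] on basis vectors without regard to [G]. Each term of the average is again sent to
   [f y] by [L], so [f1] is still a lift, and it inherits injectivity from [f]. *)
pose f1 y := #|G|%:R^-1 *: \sum_(g in G) act g^-1%g (f0 (rG g *m y)).
have f1lin : linear f1.
  move=> a y z; rewrite /f1 scalerA mulrC -scalerA -scalerDr; congr (_ *: _).
  rewrite scaler_sumr -big_split; apply: eq_bigr => g _ /=.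
  rewrite -act_lin; congr (act _ _); rewrite mulmxDr -scalemxAr /f0 scaler_sumr -big_split.
  by apply: eq_bigr => j _; rewrite /= !mxE scalerDl scalerA.
have [f' hf'] := linear_of f1lin.
have f'M y : M (f' y).
  by rewrite hf'; apply: M_scale; apply: M_sum => g gG; apply: M_act; rewrite ?groupV.
have Lf' y : L (f' y) = f y.
  rewrite hf' /f1 linearZ linear_sum /=.
  rewrite (eq_bigr (fun=> f y)) => [|g gG]; last by rewrite Leq ?groupV // Lf0 feq // act'K.
  by rewrite sumr_const -scaler_nat scalerA mulVf // scale1r.
exists f'; split => //.
  by move=> y z e; apply: finj; rewrite -!Lf' e.
move=> h hG y; rewrite !hf' /f1 act_scale; congr (_ *: _).
rewrite act_sum (reindex_inj (mulIg h^-1%g)) /=.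
apply: eq_big => [g|g]; first by rewrite groupMr ?groupV.
rewrite groupMr ?groupV // => gG.
rewrite invMg invgK act_morph ?groupV //; congr (act _ (act _ (f0 _))).
by rewrite mulmxA -repr_mxM ?groupM ?groupV // mulgKV.
Qed.

End Isotypic.

(** * Reciprocal diagrams and self-stresses *)

Definition quarter {R : realType} : 'M[R]_2 := mx2 0 (-1) 1 0.

Lemma rot_quarter (R : realType) (th : R) :
  \det (Defs.rot th) = 1 /\ Defs.rot th *m quarter = quarter *m Defs.rot th.
Proof.
split; first by rewrite det_mx22 !mxE /= mulNr opprK -!expr2 cos2Dsin2.
by apply: mx22P; rewrite !mxE !sum_I2 !mxE /=; ring.
Qed.

Lemma refl_quarter (R : realType) (th : R) :
  \det (refl th) = -1 /\ refl th *m quarter = - (quarter *m refl th).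
Proof.
split; first by rewrite det_mx22 !mxE /= mulrN -opprD -!expr2 cos2Dsin2.
by apply: mx22P; rewrite !mxE !sum_I2 !mxE /=; ring.
Qed.

(** A reflection reverses the orientation of the plane and so anticommutes with the quarter turn
    that defines [leftnormal]. The same bit gives the determinant, that is the sign [[gf,f]]. *)
Lemma standard_rep_sign (R : realType) (gT : finGroupType) (G : {group gT})
    (tau : gT -> 'M[R]_2) m : standard_rep G tau m -> forall g, g \in G ->
  exists b : bool, \det (tau g) = (-1) ^+ b /\
    quarter *m tau g = (-1) ^+ b *: (tau g *m quarter).
Proof.
move=> [_ _ _ H] g gG; case: H => [H|[th H]].
  have [i ->] := iffLR (H (tau g)) (ex_intro2 _ _ g gG erefl).
  by exists false; have [d1 q1] := rot_quarter (2 * pi * i%:R / m%:R : R); rewrite /rot_m d1 -q1 scale1r.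
have [i [->|->]] := iffLR (H (tau g)) (ex_intro2 _ _ g gG erefl).
  by exists false; have [d1 q1] := rot_quarter (2 * pi * i%:R / m%:R : R); rewrite /rot_m d1 -q1 scale1r.
exists true; have [d1 q1] := rot_quarter (2 * pi * i%:R / m%:R : R).
have [d2 q2] := refl_quarter th; rewrite /rot_m det_mulmx d1 d2 mul1r; split=> //.
by rewrite mulmxA -q1 -!mulmxA q2 mulmxN scaleN1r opprK.
Qed.

Section Reciprocal.
Variables (R : realType) (k : fieldType) (iota : {rmorphism R -> k}).
Variables (gT : finGroupType) (G : {group gT}) (tau : gT -> 'M[R]_2) (m : nat).
Hypothesis Htau : standard_rep G tau m.
Variables (V E F : finType) (tl hd : E -> V) (p : V -> 'cV[R]_2) (face : F -> set 'cV[R]_2).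
Hypothesis Hemb : planar_embedding tl hd p.
Hypothesis Hfaces : faces_of_drawing tl hd p face.
Hypothesis Hreg : regular_faces tl hd p face.
Variables (aV : gT -> V -> V) (aE : gT -> E -> E) (aF : gT -> F -> F).
Hypothesis Hact : G_action G tau tl hd p face aV aE aF.

Local Notation act2 := (actC2 iota tau aF).
Local Notation bd := (bd2const tl hd p face).
Local Notation phi := (phiE iota tl hd p).
Local Notation th := (theta iota tl hd p face).
Local Notation H2 := (H2P iota tl hd p face).
Local Notation H1 := (H1F iota tl hd p).
Implicit Types (xi : {ffun F -> 'cV[k]_2}) (e : E).

Lemma sides_exist : exists Lf Rf : E -> F,
  (forall e, side_face tl hd p face e 1 (Lf e)) /\
  (forall e, side_face tl hd p face e (-1) (Rf e)).
Proof.
have [Lf HL] := choice (fun e => side_face_exists Hemb Hfaces e (oner_neq0 R)).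
have [Rf HR] := choice (fun e => side_face_exists Hemb Hfaces e (ltr0_neq0 (ltrN10 R))).
by exists Lf, Rf.
Qed.

Lemma bd_jump Lf Rf xi : (forall e, side_face tl hd p face e 1 (Lf e)) ->
  (forall e, side_face tl hd p face e (-1) (Rf e)) ->
  forall e, bd xi e = xi (Lf e) - xi (Rf e).
Proof. by move=> HL HR e; rewrite /bd2const (sum_incEF Hemb Hfaces Hreg HL HR). Qed.

Lemma bd_eq0 xi : Tconst xi <-> (forall e, bd xi e = 0).
Proof.
have [Lf [Rf [HL HR]]] := sides_exist; split.
  by move=> [a xa] e; rewrite (bd_jump _ HL HR) !xa subrr.
(* The common vector is read off some face; if there were none, any vector would do. *)
move=> b0; have [f0|nf] := pselect (exists f : F, True); last first.
  by exists 0 => f; case: nf; exists f.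
have [f0' _] := f0; exists (xi f0') => f.
apply: (jump0_const Hemb Hfaces HL HR) => e.
by rewrite -[LHS](bd_jump _ HL HR).
Qed.

(** The identity that the boundary of a boundary vanishes, for the constant cosheaf. *)
Lemma bd_flow xi : flow tl hd (bd xi).
Proof.
have [Lf [Rf [HL HR]]] := sides_exist => v.
under eq_bigr do rewrite (bd_jump _ HL HR).
exact: (vertex_jump Hemb Hfaces HL HR).
Qed.

(** The vanishing of the first homology of the constant cosheaf on the sphere. *)
Lemma flow_bd (a : E -> 'cV[k]_2) : flow tl hd a -> exists xi, forall e, bd xi e = a e.
Proof.
have [Lf [Rf [HL HR]]] := sides_exist => fa.
have [xi hxi] := flow_jump Hemb Hfaces HL HR fa; exists [ffun f => xi f] => e.
by rewrite (bd_jump _ HL HR) !ffunE; exact: hxi.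
Qed.

Lemma bd_lin (a : k) xi xi' e : bd (a *: xi + xi') e = a *: bd xi e + bd xi' e.
Proof.
rewrite /bd2const scaler_sumr -big_split; apply: eq_bigr => f _ /=.
by rewrite !ffunE scalerDr scalerA mulrC -scalerA.
Qed.

Lemma phi_map e : phi e = map_mx iota (p (hd e) - p (tl e)).
Proof.
by rewrite /phiE /Fext /incVE /other_end eqxx scale1r map_mxB.
Qed.

Lemma phi_neq0 e : phi e != 0.
Proof.
have [_ Hne _ _] := Hemb.
by rewrite phi_map map_mx_eq0 subr_eq0 eq_sym.
Qed.

Lemma phi_invK (d : 'cV[k]_2) c : d != 0 -> phi_inv d (c *: d) = c.
Proof.
move=> d0; rewrite /phi_inv !mxE; case: ifPn => h; first by rewrite mulfK.
rewrite mulfK //; apply: contra_neq d0 => h1; move/negPn/eqP: h => h0.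
apply/matrixP => i j; rewrite ord1 mxE.
by case: i => -[|[|//]] hi; [rewrite -[RHS]h0|rewrite -[RHS]h1]; congr (d _ _); apply: val_inj.
Qed.

Lemma theta_phi xi e : H2 xi -> th xi e *: phi e = bd xi e.
Proof.
move=> /(_ e)[c bc]; rewrite /theta ffunE bc phi_invK //; exact: phi_neq0.
Qed.

(** For a fixed [d], [phi_inv d] divides a fixed coordinate by a constant. It is thus linear even
    off the span of [d], and [theta] is linear on all 2-chains. *)
Lemma theta_lin : linear th.
Proof.
move=> a xi xi'; apply/ffunP => e; rewrite !ffunE bd_lin /phi_inv.
by case: ifP => _; rewrite !mxE mulrDl -mulrA.
Qed.

(** [Fext v e] is the same vector for both endpoints, since exchanging them flips the sign and the
    difference together; equilibrium at [v] is therefore conservation of [w e *: phi e]. *)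
Lemma H1_flow w : H1 w <-> flow tl hd (fun e => w e *: phi e).
Proof.
have inc v e : (incVE tl hd v e)%:~R *: ((w e : k) *: Fext iota tl hd p v e) =
    ((w e : k) *: phi e) *~ incVE tl hd v e.
  rewrite scaler_int /phiE; have [->//|nh] := eqVneq v (hd e).
  rewrite [incVE _ _ v e]/incVE (negbTE nh); have [vt|nt] := eqVneq v (tl e); last by rewrite !mulr0z.
  congr ((_ *: _) *~ _); rewrite /Fext /incVE /other_end eqxx (negbTE nh) vt eqxx.
  by rewrite scale1r scaleN1r opprB.
split=> h v; rewrite -[RHS](h v); apply: eq_bigr => e _; [exact/esym/inc|exact: inc].
Qed.

Lemma theta_H1 xi : H2 xi -> H1 (th xi).
Proof.
move=> hxi; apply/H1_flow => v; under eq_bigr do rewrite theta_phi //.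
exact: bd_flow.
Qed.

Lemma theta_onto w : H1 w -> exists2 xi, H2 xi & th xi = w.
Proof.
move=> /H1_flow/flow_bd[xi hxi]; exists xi; first by move=> e; exists (w e); exact: hxi.
by apply/ffunP => e; rewrite ffunE hxi phi_invK // phi_neq0.
Qed.

Lemma H2_lin (a : k) xi xi' : H2 xi -> H2 xi' -> H2 (a *: xi + xi').
Proof.
move=> h h' e; have [c hc] := h e; have [c' hc'] := h' e; exists (a * c + c').
by rewrite bd_lin hc hc' scalerDl scalerA.
Qed.

Lemma Tconst_H2 xi : Tconst xi -> H2 xi.
Proof. by move=> /bd_eq0 h e; exists 0; rewrite h scale0r. Qed.

Lemma theta_eq0 xi : H2 xi -> th xi = 0 <-> Tconst xi.
Proof.
move=> hxi; split=> [t0|/bd_eq0 h].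
  by apply/bd_eq0 => e; rewrite -theta_phi // t0 ffunE scale0r.
by apply/ffunP => e; rewrite ffunE h ffunE -[X in phi_inv _ X](scale0r (phi e)) phi_invK // phi_neq0.
Qed.

Lemma aFK g : g \in G -> cancel (aF g) (aF g^-1%g).
Proof.
have [[_ _ [H H0]] _ _ _] := Hact.
by move=> gG f; have := H _ _ (groupVr gG) gG f; rewrite mulVg H0.
Qed.

Lemma aEK g : g \in G -> cancel (aE g) (aE g^-1%g).
Proof.
have [[_ [H H0] _] _ _ _] := Hact.
by move=> gG e; have := H _ _ (groupVr gG) gG e; rewrite mulVg H0.
Qed.

Lemma edge_symmetry g e : g \in G -> exists b : bool,
  phi (aE g e) = (-1) ^+ b *: (tauk iota tau g *m phi e) /\
  forall xi, bd (act2 g xi) (aE g e) = (-1) ^+ b *: (tauk iota tau g *m bd xi e).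
Proof.
move=> gG; have [_ actp actE actf] := Hact.
have [c [detc Jc]] := standard_rep_sign Htau gG.
have [b hb] : exists b : bool, p (hd (aE g e)) - p (tl (aE g e)) =
    (-1) ^+ b *: (tau g *m (p (hd e) - p (tl e))).
  have [[-> ->]|[-> ->]] := actE _ gG e; [exists false|exists true].
    by rewrite scale1r !actp // mulmxBr.
  by rewrite scaleN1r !actp // mulmxBr opprB.
have hm : midE tl hd p (aE g e) = tau g *m midE tl hd p e.
  rewrite /midE -scalemxAr mulmxDr; congr (_ *: _).
  by have [[-> ->]|[-> ->]] := actE _ gG e; rewrite !actp // addrC.
have hn : leftnormal tl hd p (aE g e) = (-1) ^+ (b (+) c) *: (tau g *m leftnormal tl hd p e).
  rewrite /leftnormal hb -scalemxAr mulmxA -/quarter Jc -scalemxAl scalerA mulmxA.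
  by rewrite signr_addb.
exists b; split.
  by rewrite !phi_map hb map_mxZ map_mxM rmorph_sign.
move=> xi; have [Lf [Rf [HL HR]]] := sides_exist.
have N10 : (-1 : R) != 0 := ltr0_neq0 (ltrN10 R).
have sm s f : s != 0 -> side_face tl hd p face e (s * (-1) ^+ (b (+) c)) f ->
    side_face tl hd p face (aE g e) s (aF g f).
  by move=> s0; apply: (side_face_map Hemb Hfaces s0 _ hm hn (actf _ gG f)); rewrite signr_eq0.
have act2E f : act2 g xi (aF g f) = (-1) ^+ c *: (tauk iota tau g *m xi f).
  by rewrite ffunE aFK // det_map_mx detc rmorph_sign.
rewrite !(bd_jump _ HL HR).
have uq1 f : side_face tl hd p face (aE g e) 1 f -> Lf (aE g e) = f.
  by apply: (side_face_uniq Hemb Hfaces (oner_neq0 R)); exact: HL.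
have uq2 f : side_face tl hd p face (aE g e) (-1) f -> Rf (aE g e) = f.
  by apply: (side_face_uniq Hemb Hfaces N10); exact: HR.
case: (boolP (b (+) c)) sm => bc sm.
- have -> : Lf (aE g e) = aF g (Rf e).
    by apply: uq1; apply: sm; rewrite ?oner_neq0 // mul1r expr1; exact: HR.
  have -> : Rf (aE g e) = aF g (Lf e).
    by apply: uq2; apply: sm => //; rewrite expr1 mulrNN mulr1; exact: HL.
  rewrite !act2E -scalerBr -mulmxBr -opprB mulmxN scalerN -scaleNr; congr (_ *: _).
  by case: (b) bc; case: (c) => // _; rewrite ?opprK.
- have -> : Lf (aE g e) = aF g (Lf e).
    by apply: uq1; apply: sm; rewrite ?oner_neq0 // mul1r expr0; exact: HL.
  have -> : Rf (aE g e) = aF g (Rf e).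
    by apply: uq2; apply: sm => //; rewrite expr0 mulr1; exact: HR.
  rewrite !act2E -scalerBr -mulmxBr; congr (_ *: _).
  by case: (b) bc; case: (c).
Qed.

Lemma H2_act g xi : g \in G -> H2 xi -> H2 (act2 g xi).
Proof.
move=> gG hxi e; pose e' := aE g^-1%g e.
have -> : e = aE g e' by rewrite /e' -{1}(invgK g) aEK // groupV.
have [b [phiG bdG]] := edge_symmetry e' gG; have [c hc] := hxi e'; exists c.
by rewrite bdG phiG hc -scalemxAr !scalerA mulrC.
Qed.

(** The sign of [edge_symmetry] affects the boundary and [phi] alike and cancels in the coefficient,
    in accordance with the trivial factor in the action on edge stresses. *)
Lemma theta_act g xi : g \in G -> H2 xi -> th (act2 g xi) = actC1F aE g (th xi).
Proof.
move=> gG hxi; apply/ffunP => e; rewrite [RHS]ffunE; pose e' := aE g^-1%g e.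
rewrite -/e'; have -> : e = aE g e' by rewrite /e' -{1}(invgK g) aEK // groupV.
have [b [phiG bdG]] := edge_symmetry e' gG.
rewrite ffunE bdG -theta_phi // -scalemxAr scalerA mulrC -scalerA -phiG phi_invK //.
exact: phi_neq0.
Qed.

Lemma act2_lin g : linear (act2 g).
Proof.
move=> a xi xi'; apply/ffunP => f; rewrite !ffunE mulmxDr scalerDr -scalemxAr.
by rewrite !scalerA mulrC.
Qed.

Lemma act2_morph : {in G &, forall g h xi, act2 (g * h)%g xi = act2 g (act2 h xi)}.
Proof.
have [_ tauM _ _] := Htau; have [[_ _ [H H0]] _ _ _] := Hact.
move=> g h gG hG xi; apply/ffunP => f; rewrite !ffunE /tauk tauM // map_mxM det_mulmx.
by rewrite invMg H ?groupV //= -mulmxA -scalemxAr scalerA.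
Qed.

Lemma act1K g : g \in G -> forall w : {ffun E -> k^o}, actC1F aE g^-1%g (actC1F aE g w) = w.
Proof. by move=> gG w; apply/ffunP => e; rewrite !ffunE invgK aEK. Qed.

(** Characteristic zero passes from [R] to [k] along [iota]; this permits division by the number of
    faces and by the order of [G]. *)
Lemma natr_neq0 j : (0 < j)%N -> (j%:R : k) != 0.
Proof. by move=> j0; rewrite -(rmorph_nat iota) fmorph_eq0 pnatr_eq0 -lt0n. Qed.

Definition face_mean xi : {ffun F -> 'cV[k]_2} :=
  [ffun=> #|F|%:R^-1 *: \sum_f xi f].

Lemma face_mean_lin : linear face_mean.
Proof.
move=> a xi xi'; apply/ffunP => f; rewrite !ffunE scalerA mulrC -scalerA -scalerDr.
by congr (_ *: _); rewrite scaler_sumr -big_split; apply: eq_bigr => f' _; rewrite !ffunE.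
Qed.

Lemma face_mean_Tconst xi : Tconst (face_mean xi).
Proof. by exists (#|F|%:R^-1 *: \sum_f xi f) => f; rewrite ffunE. Qed.

Lemma face_mean_id xi : Tconst xi -> face_mean xi = xi.
Proof.
move=> [a xa]; apply/ffunP => f; rewrite ffunE xa.
rewrite (eq_bigr (fun=> a)) // sumr_const -scaler_nat scalerA mulVf ?scale1r //.
by apply: natr_neq0; apply/card_gt0P; exists f.
Qed.

Lemma face_mean_act g xi : g \in G -> face_mean (act2 g xi) = act2 g (face_mean xi).
Proof.
move=> gG; apply/ffunP => f; rewrite !ffunE -scalemxAr scalerA mulrC -scalerA.
congr (_ *: _); rewrite mulmx_sumr scaler_sumr (reindex_inj (can_inj (aFK gG))) /=.
by apply: eq_bigr => f' _; rewrite ffunE aFK.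
Qed.

End Reciprocal.

Theorem mainTheorem7
  (R : realType) (k : fieldType) (iota : {rmorphism R -> k})
  (Hk : k_is_R_or_C iota)
  (gT : finGroupType) (G : {group gT}) (tau : gT -> 'M[R]_2) (m : nat)
  (Htau : standard_rep G tau m)
  (V E F : finType) (tl hd : E -> V) (p : V -> 'cV[R]_2) (face : F -> set 'cV[R]_2)
  (Hemb : planar_embedding tl hd p)
  (Hfaces : faces_of_drawing tl hd p face)
  (Hreg : regular_faces tl hd p face)
  (aV : gT -> V -> V) (aE : gT -> E -> E) (aF : gT -> F -> F)
  (Hact : G_action G tau tl hd p face aV aE aF)
  (n : nat) (rG : mx_representation k G n) (Hirr : mx_irreducible rG) :
  let act2 := actC2 iota tau aF in
  let act1 := actC1F aE in
  let T := Tconst (k := k) (F := F) in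
  let H2 := H2P iota tl hd p face in
  let H1 := H1F iota tl hd p in
  let th := theta iota tl hd p face in
  [/\ (* T = H_2 of the constant cosheaf (the 2-cycles) *)
      (forall xi, T xi <-> (forall e, bd2const tl hd p face xi e = 0)),
      (* pi_* (the identity on 2-chains) maps T^(j) into H_2^(j) P *)
      (forall xi, isotypic rG act2 T xi -> isotypic rG act2 H2 xi),
      (* theta maps H_2^(j) P into H_1^(j) F, equivariantly *)
      (forall xi, isotypic rG act2 H2 xi -> isotypic rG act1 H1 (th xi))
        /\ (forall g, g \in G -> forall xi, H2 xi -> th (act2 g xi) = act1 g (th xi)),
      (* exactness in the middle: ker theta^(j) = pi_*(T^(j)) *)
      (forall xi, isotypic rG act2 H2 xi -> (th xi = 0 <-> isotypic rG act2 T xi)) &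
      (* theta^(j) is onto H_1^(j) F *)
      (forall w, isotypic rG act1 H1 w -> exists2 xi, isotypic rG act2 H2 xi & th xi = w)].
Proof.
move=> act2 act1 T H2 H1 th.
have act2_0 g : act2 g 0 = 0.
  by apply/ffunP => f; rewrite !ffunE mulmx0 scaler0.
have act1_0 g : act1 g 0 = 0 by apply/ffunP => e; rewrite !ffunE.
have [L hL] := linear_of (theta_lin iota tl hd p face).
have TH2 xi : T xi -> H2 xi := @Tconst_H2 _ _ iota _ _ _ _ _ _ _ Hemb Hfaces Hreg xi.
split.
- by move=> xi; exact: bd_eq0.
- by move=> xi; exact: isotypicS.
- split; last by move=> g gG xi; exact: (theta_act Htau Hemb Hfaces Hreg Hact).
  move=> xi hxi; rewrite /th -hL; apply: isotypic_map hxi => //.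
  + by move=> x hx; rewrite hL; exact: theta_H1.
  + by move=> g gG x hx; rewrite !hL; exact: (theta_act Htau Hemb Hfaces Hreg Hact).
- have iso_H2 xi : isotypic rG act2 H2 xi -> H2 xi.
    move=> [N [fs [ys [h ->]]]]; elim/big_ind: _ => [|x y hx hy|i _].
    + by apply: TH2; exists 0 => f; rewrite ffunE.
    + by rewrite -[x]scale1r; exact: H2_lin.
    + by have [_ h2 _] := h i.
  move=> xi hxi; rewrite (theta_eq0 Hemb Hfaces Hreg (iso_H2 _ hxi)); split; last first.
    move=> [N [fs [ys [h ->]]]].
    have /choice[c hc] i : T (fs i (ys i)) by have [_ h2 _] := h i.
    exists (\sum_i c i) => f; rewrite sum_ffunE; apply: eq_bigr => i _; exact: hc.
  (* Although [xi] is constant, the summands that exhibit it in the isotypic component of [H2] need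
     not be. The mean over faces fixes [xi] and carries each summand into [T]. *)
  move=> Txi; have [P hP] := linear_of (@face_mean_lin k F).
  rewrite -(face_mean_id iota Txi) -hP; apply: isotypic_map hxi => //.
  + by move=> x _; rewrite hP; exact: face_mean_Tconst.
  + by move=> g gG x _; rewrite !hP; exact: (face_mean_act _ Hact).
- move=> w hw; have char0 : (#|G|%:R : k) != 0 by apply: natr_neq0 (cardG_gt0 G); exact: iota.
  have [] := @isotypic_lift _ _ _ _ rG _ _ act2 act1 H2 H1 L _ char0 _ _ _ _ _ _ _ w hw.
  + by move=> g gG x hx; rewrite !hL; exact: (theta_act Htau Hemb Hfaces Hreg Hact).
  + exact: H2_lin.
  + by apply: TH2; exists 0 => f; rewrite ffunE.
  + by move=> g gG x; exact: (H2_act Htau Hemb Hfaces Hreg Hact).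
  + exact: act2_lin.
  + exact: (act2_morph _ Htau Hact).
  + exact: (act1K Hact).
  + by move=> x' /(theta_onto Hemb Hfaces Hreg)[x hx <-]; exists x.
  + by move=> x hx <-; exists x.
Qed.
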